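(* Let $d\ge1$, let $\Lambda\subset\mathbb{R}^d$ be a lattice and let $0<s<d$. For every open bounded set $\mathcal{D}\subset\mathbb{R}^d$ whose boundary has Lebesgue measure zero and such that $|\mathcal{D}||\Lambda|=1$, one has $$I_\nu^{\mathcal{D}}(d-s)\le I_\nu^{\mathcal{D}^*}(d-s),$$ where $\mathcal{D}^*=B(0,r_d)$ is the open ball centered at the origin with radius $r_d=\left(\frac{d\,|\mathcal{D}|}{\omega_{d-1}}\right)^{1/d}$, so that $|\mathcal{D}^*|=|\mathcal{D}|$. That is, for fixed $\Lambda$, among all such sets $\mathcal{D}$ the centered ball maximizes $I_\nu^{\mathcal{D}}(d-s)$, and hence it minimizes the coefficient $$-\frac{\pi^{s-\frac d2}\,\Gamma\left(\frac{d-s}2\right)}{\Gamma\left(\frac s2\right)|\Lambda|}\,I_\nu^{\mathcal{D}}(d-s)$$ which multiplies $t_N^{1+s/d}$ in the asymptotic expansion of the expected periodic Riesz $s$-energy of the determinantal processes on $\mathbb{R}^d/\Lambda$ associated with $\mathcal{D}$ and $\Lambda$.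
   Context: A lattice is $\Lambda=A\mathbb{Z}^d$ with $A$ a nonsingular real $d\times d$ matrix, with co-volume $|\Lambda|=|\det A|$ and dual lattice $\Lambda^*=(A^t)^{-1}\mathbb{Z}^d$. For a measurable set $\mathcal{D}\subset\mathbb{R}^d$, $|\mathcal{D}|$ is its Lebesgue measure. $\omega_{d-1}=d\,\pi^{d/2}/\Gamma\left(\frac d2+1\right)$ is the surface measure of the unit sphere $\mathbb{S}^{d-1}\subset\mathbb{R}^d$. For $0<t<d$, $$I_\nu^{\mathcal{D}}(t)=\int_{\mathcal{D}\times\mathcal{D}}\frac{1}{|x-y|^t}\,d\nu(x)\,d\nu(y),$$ where $\nu$ is the multiple of Lebesgue measure on $\mathbb{R}^d$ such that a fundamental domain of $\Lambda^*$ has $\nu$-measure $1$ (i.e. $\nu=|\Lambda|$ times Lebesgue measure). The determinantal process associated with $\mathcal{D}$ and $\Lambda$ at level $N$ is the one on $\mathbb{R}^d/\Lambda$ (with normalized Lebesgue measure) with kernel $K_N(u,v)=\sum_{w\in\Lambda^*\cap N^{1/d}\mathcal{D}}e^{2\pi i\langle u-v,w\rangle}$; it has $t_N=\#(\Lambda^*\cap N^{1/d}\mathcal{D})$ points almost surely. The expansion referred to is that, as $N\to\infty$, its expected periodic Riesz $s$-energy equals $$\frac{2\pi^{d/2}|\Lambda|^{-1}}{\Gamma(\frac s2)(d-s)}t_N^2-\frac{\pi^{s-\frac d2}\Gamma(\frac{d-s}2)}{\Gamma(\frac s2)|\Lambda|}I_\nu^{\mathcal{D}}(d-s)\,t_N^{1+s/d}+o(t_N^{1+s/d}).$$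 Here the periodic Riesz $s$-energy of $(x_1,\dots,x_n)$ is $\sum_{k\ne j}F_{s,\Lambda}(x_k-x_j)$ with $$F_{s,\Lambda}(x)=\sum_{v\in\Lambda}\int_1^{+\infty}e^{-|x+v|^2t}\frac{t^{\frac s2-1}}{\Gamma(\frac s2)}\,dt+\frac1{|\Lambda|}\sum_{w\in\Lambda^*\setminus\{0\}}e^{2\pi i\langle x,w\rangle}\int_0^1\frac{\pi^{d/2}}{t^{d/2}}e^{-\frac{\pi^2|w|^2}{t}}\frac{t^{\frac s2-1}}{\Gamma(\frac s2)}\,dt.$$ *)

(* Defs.v *)
From HB Require Import structures.
From mathcomp Require Import all_boot all_order all_algebra finmap.
From mathcomp Require Import all_classical all_reals all_analysis.
From mathcomp Require Import complex.

Set Implicit Arguments.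
Unset Strict Implicit.
Unset Printing Implicit Defensive.
Import Order.TTheory GRing.Theory Num.Theory.
Import numFieldNormedType.Exports.
Local Open Scope classical_set_scope.
Local Open Scope ring_scope.

Section measure_with_sigma_finite.
Context d (T : measurableType d) (R : realType).
Variable m : {measure set T -> \bar R}.
Hypothesis msf : sigma_finite setT m.

Let m' A := m A.
Let m'0 : m' set0 = 0%E. Proof. exact: measure0. Qed.
Let m'_ge0 A : (0 <= m' A)%E. Proof. exact: measure_ge0. Qed.
Let m'_sigma_additive : semi_sigma_additive m'.
Proof. exact: measure_semi_sigma_additive. Qed.
HB.instance Definition _ := isMeasure.Build _ _ _ m'
  m'0 m'_ge0 m'_sigma_additive.
HB.instance Definition _ := @Measure_isSigmaFinite.Build _ _ _ m' msf.

Lemma sigma_finite_measureP :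
  exists p : {sigma_finite_measure set T -> \bar R}, forall A, m A = p A.
Proof. by exists m'. Qed.

End measure_with_sigma_finite.

Lemma sigma_finite_product d1 d2 (T1 : measurableType d1)
    (T2 : measurableType d2) (R : realType)
    (m1 : {sigma_finite_measure set T1 -> \bar R})
    (m2 : {sigma_finite_measure set T2 -> \bar R}) :
  sigma_finite setT (m1 \x m2)%E.
Proof.
have /sigma_finiteP[F [TF ndF Foo]] := sigma_finiteT m1.
have /sigma_finiteP[G [TG ndG Goo]] := sigma_finiteT m2.
exists (fun n => F n `*` G n).
  rewrite -setXTT TF TG predeqE => -[x y]; split.
    move=> [/= [n _ Fnx] [k _ Gky]]; exists (maxn n k) => //; split.
    - by move: x Fnx; exact/subsetPset/ndF/leq_maxl.
    - by move: y Gky; exact/subsetPset/ndG/leq_maxr.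
  by move=> [n _ []/= ? ?]; split; exists n.
move=> k; have [? ?] := Foo k; have [? ?] := Goo k.
split; first exact: measurableX.
by rewrite product_measure1E// lte_mul_pinfty// ge0_fin_numE.
Qed.

Lemma sigma_finite_pushforward d1 d2 (T1 : measurableType d1)
    (T2 : measurableType d2) (R : realType)
    (mu : {measure set T1 -> \bar R}) (f : T1 -> T2) (g : T2 -> T1) :
  sigma_finite setT mu ->
  measurable_fun setT f -> measurable_fun setT g -> cancel f g ->
  exists m : {sigma_finite_measure set T2 -> \bar R}, pushforward mu f = m.
Proof.
move=> [F FT mF] mf mg fK.
have sf : sigma_finite setT (pushforward mu f).
  exists (fun n => g @^-1` F n).
    by rewrite -preimage_bigcup -FT preimage_setT.
  move=> n; have [mFn Fn_oo] := mF n; split.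
    by rewrite -[_ @^-1` _]setTI; exact: mg.
  rewrite /pushforward (_ : f @^-1` _ = F n)//.
  by apply/seteqP; split=> x /=; rewrite fK.
have [p pE] : exists p : {measure set T2 -> \bar R}, pushforward mu f = p.
  by unshelve eexists (pushforward mu f).
rewrite pE in sf *.
have [q qE] := sigma_finite_measureP sf.
by exists q; exact/funext.
Qed.

Section tuple_measure.
Context d (T : measurableType d) (R : realType).
Variable mu : {sigma_finite_measure set T -> \bar R}.

(* The n-fold product of mu on n.-tuple T, as an iterated integral. *)
Fixpoint tuple_measure n : set (n.-tuple T) -> \bar R :=
  if n is n'.+1 then fun B =>
    (\int[mu]_x tuple_measure [set t : n'.-tuple T | B [tuple of x :: t]])%E
  else fun B => \d_[tuple] B.

Lemma tuple_measureP n :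
  exists m : {sigma_finite_measure set (n.-tuple T) -> \bar R},
    tuple_measure (n := n) = m.
Proof.
elim: n => [|n [m mE]]; first by eexists; reflexivity.
pose f (p : T * n.-tuple T) := [tuple of p.1 :: p.2].
pose g (t : n.+1.-tuple T) := (thead t, [tuple of behead t]).
have mf : measurable_fun setT f by exact: measurable_cons.
have mg : measurable_fun setT g.
  apply/measurable_fun_pairP; split.
    exact: (measurable_tnth ord0).
  exact: measurable_behead.
have fK : cancel f g.
  by move=> [x t]; rewrite /f /g theadE; congr pair; exact/val_inj.
pose mum : {measure set (T * n.-tuple T)%type -> \bar R} := (mu \x m)%E.
have [p pE] := sigma_finite_pushforward
  (mu := mum) (sigma_finite_product mu m) mf mg fK.
exists p; rewrite -pE; apply/funext => B /=.
rewrite /pushforward /mum/= /product_measure1.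
apply: eq_integral => x _ /=; rewrite mE; congr (m _).
by apply/seteqP; split=> t; rewrite /xsection/= ?inE// => /set_mem.
Qed.

Section instances.
Variable n : nat.
Let m : set (n.-tuple T) -> \bar R := tuple_measure (n := n).

Let m0 : m set0 = 0%E.
Proof. by have [p pE] := tuple_measureP n; rewrite /m pE measure0. Qed.
Let m_ge0 A : (0 <= m A)%E.
Proof. by have [p pE] := tuple_measureP n; rewrite /m pE. Qed.
Let m_sigma_additive : semi_sigma_additive m.
Proof.
have [p pE] := tuple_measureP n; rewrite /m pE.
exact: measure_semi_sigma_additive.
Qed.
Let m_sigma_finite : sigma_finite setT m.
Proof.
by have [p pE] := tuple_measureP n; rewrite /m pE; exact: sigma_finiteT.
Qed.

HB.instance Definition _ := isMeasure.Build _ _ _ (@tuple_measure n)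
  m0 m_ge0 m_sigma_additive.
HB.instance Definition _ :=
  @Measure_isSigmaFinite.Build _ _ _ (@tuple_measure n) m_sigma_finite.
End instances.

End tuple_measure.

(* The sigma-algebra on column vectors generated by the coordinates, as the
   library does for tuples; it coincides with the Borel sigma-algebra. *)
Section measurable_colvec.
Context (R : realType) (d : nat).

Definition colvec_coord (i : 'I_d) (x : 'cV[R]_d) : R := x i ord0.

Let colvec_set0 : g_sigma_preimage colvec_coord set0.
Proof. exact: sigma_algebra0. Qed.
Let colvec_setC A :
  g_sigma_preimage colvec_coord A -> g_sigma_preimage colvec_coord (~` A).
Proof. exact: sigma_algebraC. Qed.
Let colvec_bigcup (F : (set 'cV[R]_d)^nat) :
  (forall i, g_sigma_preimage colvec_coord (F i)) ->
  g_sigma_preimage colvec_coord (\bigcup_i F i).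
Proof. exact: sigma_algebra_bigcup. Qed.

HB.instance Definition _ :=
  @isMeasurable.Build (measure_tuple_display default_measure_display)
    'cV[R]_d (g_sigma_preimage colvec_coord)
    colvec_set0 colvec_setC colvec_bigcup.

End measurable_colvec.

Section lebesgue_colvec.
Context (R : realType) (d : nat).

Definition colvec_of_tuple (t : d.-tuple (measurableTypeR R)) : 'cV[R]_d :=
  \col_i tnth t i.

Definition tuple_of_colvec (x : 'cV[R]_d) : d.-tuple (measurableTypeR R) :=
  [tuple x i ord0 | i < d].

Lemma colvec_of_tupleK : cancel colvec_of_tuple tuple_of_colvec.
Proof. by move=> t; apply: eq_from_tnth => i; rewrite tnth_mktuple mxE. Qed.

Lemma measurable_colvec_of_tuple : measurable_fun setT colvec_of_tuple.
Proof.
suff : g_sigma_preimage (fun i => @colvec_coord R d i \o colvec_of_tuple)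
    `<=` measurable.
  rewrite g_sigma_preimage_comp => H _ B mB; apply: H.
  by exists B => //; rewrite setTI.
rewrite /g_sigma_preimage; apply: smallest_sub.
  exact: sigma_algebra_measurable.
elim/big_ind : _ => [//|A B sA sB C [/sA|/sB]//|i _].
move=> _ [B mB <-]; rewrite setTI.
have -> : (@colvec_coord R d i \o colvec_of_tuple) @^-1` B =
    setT `&` (fun t => tnth t i) @^-1` B.
  by rewrite setTI; apply/seteqP; split=> t; rewrite /= /colvec_coord mxE.
exact: (@measurable_tnth _ (measurableTypeR R) d i).
Qed.

Lemma measurable_tuple_of_colvec : measurable_fun setT tuple_of_colvec.
Proof.
apply/measurable_fun_tnthP => i _ B mB; rewrite setTI.
have -> : (@tnth _ (measurableTypeR R) ^~ i \o tuple_of_colvec) @^-1` B =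
    @colvec_coord R d i @^-1` B.
  by apply/seteqP; split=> x; rewrite /= tnth_mktuple.
apply: sub_sigma_algebra; rewrite -bigcup_seq/=.
exists i => /=; first by rewrite mem_index_enum.
by exists B => //; rewrite setTI.
Qed.

(* Lebesgue measure on R^d *)
Definition lebesgue_cV : set 'cV[R]_d -> \bar R :=
  pushforward (tuple_measure lebesgue_measure (n := d)) colvec_of_tuple.

Lemma lebesgue_cVP :
  exists m : {sigma_finite_measure set 'cV[R]_d -> \bar R}, lebesgue_cV = m.
Proof.
exact: (sigma_finite_pushforward (sigma_finiteT _) measurable_colvec_of_tuple
  measurable_tuple_of_colvec colvec_of_tupleK).
Qed.

(* c times Lebesgue measure, for c >= 0 *)
Definition lebesgue_scale (c : {nonneg R}) (B : set 'cV[R]_d) : \bar R :=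
  (c%:num%:E * lebesgue_cV B)%E.

Section instances.

Let m0 : lebesgue_cV set0 = 0%E.
Proof. by have [p ->] := lebesgue_cVP; rewrite measure0. Qed.
Let m_ge0 A : (0 <= lebesgue_cV A)%E.
Proof. by have [p ->] := lebesgue_cVP. Qed.
Let m_sigma_additive : semi_sigma_additive lebesgue_cV.
Proof. by have [p ->] := lebesgue_cVP; exact: measure_semi_sigma_additive. Qed.
Let m_sigma_finite : sigma_finite setT lebesgue_cV.
Proof. by have [p ->] := lebesgue_cVP; exact: sigma_finiteT. Qed.

HB.instance Definition _ := isMeasure.Build _ _ _ lebesgue_cV
  m0 m_ge0 m_sigma_additive.
HB.instance Definition _ :=
  @Measure_isSigmaFinite.Build _ _ _ lebesgue_cV m_sigma_finite.

Variable c : {nonneg R}.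
Let s0 : lebesgue_scale c set0 = 0%E.
Proof. exact: (measure0 (mscale c lebesgue_cV)). Qed.
Let s_ge0 A : (0 <= lebesgue_scale c A)%E.
Proof. exact: (measure_ge0 (mscale c lebesgue_cV)). Qed.
Let s_sigma_additive : semi_sigma_additive (lebesgue_scale c).
Proof. exact: (@measure_semi_sigma_additive _ _ _ (mscale c lebesgue_cV)). Qed.
Let s_sigma_finite : sigma_finite setT (lebesgue_scale c).
Proof.
have [F FT mF] := m_sigma_finite; exists F => // n; have [? ?] := mF n.
by split=> //; rewrite /lebesgue_scale lte_mul_pinfty.
Qed.

HB.instance Definition _ := isMeasure.Build _ _ _ (lebesgue_scale c)
  s0 s_ge0 s_sigma_additive.
HB.instance Definition _ :=
  @Measure_isSigmaFinite.Build _ _ _ (lebesgue_scale c) s_sigma_finite.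

End instances.
End lebesgue_colvec.
Arguments lebesgue_cV {R d}.

Section gamma.
Context {R : realType}.

(* Euler's Gamma function, for x > 0 *)
Definition Gamma (x : R) : R :=
  \int[lebesgue_measure]_(t in `]0, +oo[) (t `^ (x - 1) * expR (- t)).

(* omega_{d-1}: the surface measure of the unit sphere of R^d *)
Definition sphere_area (d : nat) : R :=
  d%:R * pi `^ (d%:R / 2) / Gamma (d%:R / 2 + 1).

End gamma.

Section lattices.
Context {R : realType} {d : nat}.
Implicit Types (A : 'M[R]_d) (x y : 'cV[R]_d).

Definition dotp x y : R := \sum_i x i ord0 * y i ord0.

(* The Euclidean norm; the library's norm on matrices is the sup norm. *)
Definition enorm x : R := Num.sqrt (dotp x x).

(* A Z^d *)
Definition lattice A : set 'cV[R]_d :=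
  [set A *m map_mx intr m | m in [set: 'cV[int]_d]].

(* (A^t)^-1 Z^d *)
Definition dual_lattice A : set 'cV[R]_d := lattice (invmx A^T).

Definition covolume A : R := `|\det A|.

Lemma covolume_ge0 A : 0 <= covolume A. Proof. exact: normr_ge0. Qed.

Lemma inv_covolume_ge0 A : 0 <= (covolume A)^-1.
Proof. by rewrite invr_ge0 covolume_ge0. Qed.

(* |Lambda| times Lebesgue measure: a fundamental domain of the dual lattice has
   measure 1. *)
Definition nu A : {sigma_finite_measure set 'cV[R]_d -> \bar R} :=
  lebesgue_scale (NngNum (covolume_ge0 A)).

(* Lebesgue measure normalized so that a fundamental domain of the lattice has
   measure 1 *)
Definition torus_measure A : {sigma_finite_measure set 'cV[R]_d -> \bar R} :=
  lebesgue_scale (NngNum (inv_covolume_ge0 A)).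

Definition eball (r : R) : set 'cV[R]_d := [set x | enorm x < r].

End lattices.

Section riesz.
Context {R : realType} {d : nat}.
Implicit Types (A : 'M[R]_d) (D : set 'cV[R]_d).

(* I_nu^D(t).  Since [0 `^ (- t) = 0] for [t != 0], the integrand is 0 instead
   of +oo on the diagonal, which is a null set for d >= 1. *)
Definition riesz_integral A D (t : R) : \bar R :=
  (\int[nu A \x nu A]_(p in D `*` D) (enorm (p.1 - p.2) `^ (- t))%:E)%E.

Definition admissible A D : Prop :=
  [/\ open D, bounded_set D,
      lebesgue_cV (closure D `\` D°) = 0%E &
      (lebesgue_cV D * (covolume A)%:E = 1)%E].

(* D^*: the radius r_d makes it a centered ball of the same measure as D. *)
Definition symmetrization D : set 'cV[R]_d :=
  eball ((d%:R * fine (lebesgue_cV D) / sphere_area d) `^ d%:R^-1).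

(* The coefficient of t_N^{1+s/d} in the expansion of the expected energy. *)
Definition second_coefficient A (s : R) D : R :=
  - (pi `^ (s - d%:R / 2) * Gamma ((d%:R - s) / 2)
       / (Gamma (s / 2) * covolume A))
  * fine (riesz_integral A D (d%:R - s)).

End riesz.

Section periodic_energy.
Context {R : realType} {d : nat}.
Implicit Types (A : 'M[R]_d) (D : set 'cV[R]_d) (x u v : 'cV[R]_d).

Definition expi (t : R) : R[i] := (cos t +i* sin t)%C.

(* The sum of an absolutely summable real family. *)
Definition real_sum (T : choiceType) (S : set T) (f : T -> R) : R :=
  fine (\esum_(i in S) (Num.max (f i) 0)%:E)
  - fine (\esum_(i in S) (Num.max (- f i) 0)%:E).

(* F_{s,Lambda}(x), which is +oo when x is in Lambda.  The second sum is real
   since w and - w contribute conjugate terms, so it is the sum of the real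
   parts of its terms. *)
Definition periodic_riesz A (s : R) x : \bar R :=
  (\esum_(v in lattice A)
     \int[lebesgue_measure]_(t in `[1%R, +oo[)
       (expR (- enorm (x + v) ^+ 2 * t) * (t `^ (s / 2 - 1) / Gamma (s / 2)))%:E
   + ((covolume A)^-1 *
      real_sum (dual_lattice A `\ 0%R) (fun w =>
        complex.Re (expi (2 * pi * dotp x w)) *
        \int[lebesgue_measure]_(t in `]0%R, 1%R])
          (pi `^ (d%:R / 2) / t `^ (d%:R / 2)
           * expR (- (pi ^+ 2 * enorm w ^+ 2 / t))
           * (t `^ (s / 2 - 1) / Gamma (s / 2)))))%:E)%E.

Definition periodic_energy A (s : R) n (x : 'I_n -> 'cV[R]_d) : \bar R :=
  (\sum_k \sum_(j | j != k) periodic_riesz A s (x k - x j)%R)%E.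

(* Lambda^* \cap N^{1/d} D *)
Definition level_set A D (N : nat) : set 'cV[R]_d :=
  dual_lattice A `&` [set (N%:R `^ d%:R^-1) *: x | x in D].

Definition level_card A D N : nat := #|` fset_set (level_set A D N)|.

Definition process_kernel A D N u v : R[i] :=
  \sum_(w <- fset_set (level_set A D N)) expi (2 * pi * dotp (u - v) w).

(* Points of R^d / Lambda are represented in the fundamental domain
   A [0,1)^d. *)
Definition fundamental_domain A : set 'cV[R]_d :=
  [set A *m u | u in [set u : 'cV[R]_d | forall i, 0 <= u i ord0 < 1]].

(* X_0, ..., X_{n-1} enumerate the points of a determinantal process with
   kernel K on R^d / Lambda: for every k, the k-th factorial moment measure has
   density det (K (x_i, x_j)) with respect to the k-th power of the normalized
   Lebesgue measure. *)
Definition determinantal A (K : 'cV[R]_d -> 'cV[R]_d -> R[i]) n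
    dT (T : measurableType dT) (P : probability T R)
    (X : 'I_n -> {RV P >-> 'cV[R]_d}) : Prop :=
  (forall i w, fundamental_domain A (X i w)) /\
  forall k (B : set (k.-tuple 'cV[R]_d)), measurable B ->
    B `<=` [set x | forall i, fundamental_domain A (tnth x i)] ->
    (\int[P]_w (\sum_(f : {ffun 'I_k -> 'I_n} | injectiveb f)
                  \1_B [tuple X (f j) w | j < k])%:E =
     \int[tuple_measure (torus_measure A) (n := k)]_(x in B)
       (complex.Re (\det (\matrix_(i, j) K (tnth x i) (tnth x j))))%:E)%E.

(* e is the expected periodic Riesz s-energy at level N. *)
Definition is_expected_energy A (s : R) D (N : nat) (e : R) : Prop :=
  exists dT (T : measurableType dT) (P : probability T R)
    (X : 'I_(level_card A D N) -> {RV P >-> 'cV[R]_d}),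
    determinantal A (process_kernel A D N) X /\
    (\int[P]_w periodic_energy A s (fun i => X i w) = e%:E)%E.

(* The expansion of E as N -> oo, with c as coefficient of t_N^{1+s/d}. *)
Definition energy_expansion A (s : R) D (c : R) (E : nat -> R) : Prop :=
  (fun N => E N
     - 2 * pi `^ (d%:R / 2) * (covolume A)^-1 / (Gamma (s / 2) * (d%:R - s))
       * (level_card A D N)%:R ^+ 2
     - c * (level_card A D N)%:R `^ (1 + s / d%:R) : R^o)
  =o_\oo (fun N => (level_card A D N)%:R `^ (1 + s / d%:R) : R^o).

End periodic_energy.

(* Main.v *)
(* Polarizing f with respect to a reflection whose positive side contains the
   origin does not decrease the double integral of f(x) f(y) k(|x - y|) for
   nonincreasing k, preserves Lipschitz constants, support radius and the volume
   of {f > 0}, and decreases the second moment by a definite amount as soon as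
   f(x) > f(y) + eps with |x| >= |y| + eps.  Hence, among the functions that are
   at least as good as a Lipschitz cutoff of the indicator of D, one whose second
   moment is within a small error of the infimum is radially decreasing up to
   eps; the bound on the volume of {f > 0} then forces it below the indicator of
   a ball of radius r_d + 2 eps, up to eps.  Letting
   eps tend to 0 (for the truncated kernel) and then letting the cutoffs increase
   to the indicator of D gives the Riesz inequality.  The volume of the ball
   comes from the Gaussian integral by slicing along the levels of |x|^2. *)
Require Import Defs.
From mathcomp Require Import all_boot all_order all_algebra.
From mathcomp Require Import all_classical all_reals all_analysis.
From mathcomp Require Import measurable_realfun gauss_integral.
From mathcomp Require Import ring lra.
From mathcomp Require finmap.
Import Order.TTheory GRing.Theory Num.Theory.
Import numFieldNormedType.Exports.
Local Open Scope classical_set_scope.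
Local Open Scope ring_scope.
Set Implicit Arguments.
Unset Strict Implicit.

(** * Euclidean geometry and measurability *)

(** No minimizer of the second moment is constructed. Competitors are kept Lipschitz so that a
    violation of radial monotonicity at two points persists on a ball whose radius depends only on
    eps and L. Polarizing then gains an amount independent of f, so a competitor within that amount
    of the infimum suffices in place of a compactness argument. What comes out is only a pointwise
    majorant, the indicator of a ball plus an error of small mass, and the error in the energy
    vanishes only against a bounded kernel: this is why the power is truncated before the
    comparison. Truncation also repairs the convention that the power is 0 at 0, under which the
    kernel is not nonincreasing up to the diagonal; the discrepancy lives on a null set because d >
    0. The claim about expansions is of another nature: an expansion determines its coefficient as
    soon as t_N is eventually positive, which follows by rounding a dilated interior point of D to
    the dual lattice. *)

Section euclidean.
Context {R : realType} {d : nat}.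
Implicit Types x y z : 'cV[R]_d.

Lemma dotpC x y : dotp x y = dotp y x.
Proof. by apply: eq_bigr => i _; rewrite mulrC. Qed.

Lemma dotpDl x y z : dotp (x + y) z = dotp x z + dotp y z.
Proof. by rewrite -big_split; apply: eq_bigr => i _; rewrite mxE mulrDl. Qed.

Lemma dotpZl a x y : dotp (a *: x) y = a * dotp x y.
Proof. by rewrite mulr_sumr; apply: eq_bigr => i _; rewrite mxE mulrA. Qed.

Lemma dotpDr x y z : dotp z (x + y) = dotp z x + dotp z y.
Proof. by rewrite dotpC dotpDl !(dotpC z). Qed.

Lemma dotpZr a x y : dotp x (a *: y) = a * dotp x y.
Proof. by rewrite dotpC dotpZl (dotpC y). Qed.

Lemma dotpNl x y : dotp (- x) y = - dotp x y.
Proof. by rewrite -scaleN1r dotpZl mulN1r. Qed.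

Lemma dotpNr x y : dotp x (- y) = - dotp x y.
Proof. by rewrite dotpC dotpNl dotpC. Qed.

Definition dotpE := (dotpDl, dotpDr, dotpNl, dotpNr, dotpZl, dotpZr).

Lemma dotp_ge0 x : 0 <= dotp x x.
Proof. by apply: sumr_ge0 => i _; rewrite -expr2 sqr_ge0. Qed.

Lemma enorm_ge0 x : 0 <= enorm x. Proof. exact: sqrtr_ge0. Qed.

Lemma enorm_sqr x : enorm x ^+ 2 = dotp x x.
Proof. by rewrite sqr_sqrtr ?dotp_ge0. Qed.

Lemma coord_le_enorm x i : `|x i ord0| <= enorm x.
Proof.
rewrite -sqrtr_sqr ler_sqrt ?dotp_ge0// /dotp (bigD1 i)//= -expr2 lerDl.
by apply: sumr_ge0 => j _; rewrite -expr2 sqr_ge0.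
Qed.

Lemma enorm0_eq0 x : enorm x = 0 -> x = 0.
Proof.
move=> x0; apply/matrixP => i j; rewrite ord1 mxE; apply/eqP.
by rewrite -normr_le0 -x0 coord_le_enorm.
Qed.

Lemma enorm0 : enorm (0 : 'cV[R]_d) = 0.
Proof. by rewrite /enorm -(scale0r 0) dotpZl mul0r sqrtr0. Qed.

Lemma enormZ a x : enorm (a *: x) = `|a| * enorm x.
Proof.
by rewrite /enorm !dotpE mulrA -expr2 sqrtrM ?sqr_ge0// sqrtr_sqr.
Qed.

Lemma enormN x : enorm (- x) = enorm x.
Proof. by rewrite -scaleN1r enormZ normrN1 mul1r. Qed.

Lemma enorm_distC x y : enorm (x - y) = enorm (y - x).
Proof. by rewrite -enormN opprB. Qed.

(** Cauchy-Schwarz, from the nonnegative squared norm of [enorm y *: x - enorm x *: y]; the null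
    cases come apart because that expansion carries a factor [enorm x * enorm y]. *)
Lemma dotp_le_enorm x y : dotp x y <= enorm x * enorm y.
Proof.
have [x0|x0] := eqVneq (enorm x) 0.
  by rewrite x0 mul0r (enorm0_eq0 x0) -(scale0r 0) dotpZl mul0r.
have [y0|y0] := eqVneq (enorm y) 0.
  by rewrite y0 mulr0 (enorm0_eq0 y0) -(scale0r 0) dotpZr mul0r.
have xy0 : 0 < enorm x * enorm y by rewrite mulr_gt0// lt0r ?x0 ?y0 enorm_ge0.
have := dotp_ge0 (enorm y *: x - enorm x *: y).
rewrite !dotpE (dotpC y x) -!enorm_sqr.
set a := enorm x in xy0 *; set b := enorm y in xy0 *; set c := dotp x y => h.
have {}h : 0 <= (2 * (a * b)) * (a * b - c).
  by apply: le_trans h _; rewrite le_eqVlt; apply/orP; left; apply/eqP; ring.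
have ab0 : 0 < 2 * (a * b) by rewrite mulr_gt0.
by rewrite -subr_ge0 -(pmulr_rge0 _ ab0).
Qed.

Lemma ler_enormD x y : enorm (x + y) <= enorm x + enorm y.
Proof.
rewrite -(@ler_pXn2r _ 2) ?nnegrE ?addr_ge0 ?enorm_ge0// enorm_sqr sqrrD.
rewrite !enorm_sqr !dotpE (dotpC y x).
by have := dotp_le_enorm x y; lra.
Qed.

Lemma ler_enorm_add x y z : enorm (x - z) <= enorm (x - y) + enorm (y - z).
Proof. by rewrite (le_trans _ (ler_enormD _ _))// addrA subrK. Qed.

Lemma enorm_le_sum x : enorm x <= \sum_i `|x i ord0|.
Proof.
rewrite -(@ler_pXn2r _ 2) ?nnegrE ?enorm_ge0 ?sumr_ge0// enorm_sqr.
rewrite expr2 mulr_suml; apply: ler_sum => i _; rewrite -[leLHS]ger0_norm ?normrM.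
  by rewrite ler_wpM2l// (bigD1 i)//= lerDl sumr_ge0.
by rewrite -expr2 sqr_ge0.
Qed.

Lemma mx_norm_le_enorm x : `|x| <= enorm x.
Proof.
rewrite /Num.norm/= mx_normrE; apply/bigmax_leP; split; first exact: enorm_ge0.
by move=> [i j] _ /=; rewrite ord1 coord_le_enorm.
Qed.

Lemma enorm_le_mx_norm x : enorm x <= d%:R * `|x|.
Proof.
rewrite (le_trans (enorm_le_sum x))//.
have -> : d%:R * `|x| = \sum_(i < d) `|x|.
  by rewrite big_const iter_addr addr0 card_ord mulr_natl.
apply: ler_sum => i _; rewrite [leRHS]/Num.norm/= mx_normrE.
by apply/bigmax_geP; right => /=; exists (i, ord0).
Qed.

Lemma open_eballP (D : set 'cV[R]_d) : open D <->
  forall x, D x -> exists2 e, 0 < e & forall y, enorm (x - y) < e -> D y.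
Proof.
split.
  move=> oD x Dx; have : nbhs x D by exact: open_nbhs_nbhs.
  move=> /nbhs_ballP[e/= e0 sub]; exists e => // y xy; apply: sub.
  rewrite -ball_normE/= /ball_/=.
  exact: le_lt_trans (mx_norm_le_enorm _) xy.
move=> H; rewrite openE => x /H[e e0 sub].
(* The sup norm and [enorm] differ by a factor at most [d]; [d.+1] keeps the radius meaningful when
   [d = 0]. *)
apply/nbhs_ballP; exists (e / d.+1%:R) => /=; first by rewrite divr_gt0.
move=> y; rewrite -ball_normE/= /ball_/= => xy; apply: sub.
rewrite (le_lt_trans (enorm_le_mx_norm _))//.
rewrite ltr_pdivlMr// mulrC in xy; apply: le_lt_trans xy.
by rewrite ler_wpM2r// ler_nat.
Qed.

End euclidean.

Section measurable_sets.
Context dT (T : measurableType dT) {R : realType}.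
Implicit Types f g : T -> R.

Lemma measurable_set_lt f g : measurable_fun setT f -> measurable_fun setT g ->
  measurable [set x | f x < g x].
Proof.
move=> mf mg; rewrite -[X in measurable X]setTI.
have := measurable_fun_ltr mf mg measurableT (Y := [set true]); exact.
Qed.

Lemma measurable_set_le f g : measurable_fun setT f -> measurable_fun setT g ->
  measurable [set x | f x <= g x].
Proof.
move=> mf mg; rewrite -[X in measurable X]setTI.
have := measurable_fun_ler mf mg measurableT (Y := [set true]); exact.
Qed.

End measurable_sets.

Section measurable_colvec.
Context {R : realType} {d : nat}.
Local Notation V := 'cV[R]_d.

Lemma measurable_fun_coord (i : 'I_d) :
  measurable_fun [set: V] (fun x => x i ord0).
Proof.
move=> _ B mB; rewrite setTI.
apply: sub_sigma_algebra; rewrite -bigcup_seq/=.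
exists i => /=; first by rewrite mem_index_enum.
by exists B => //; rewrite setTI.
Qed.

Lemma measurable_fun_colvec dT (T : measurableType dT) (f : T -> V) :
  (forall i, measurable_fun setT (fun t => f t i ord0)) -> measurable_fun setT f.
Proof.
move=> mf.
suff : g_sigma_preimage (fun i => @colvec_coord R d i \o f) `<=` measurable.
  rewrite g_sigma_preimage_comp => H _ B mB; apply: H.
  by exists B => //; rewrite setTI.
rewrite /g_sigma_preimage; apply: smallest_sub.
  exact: sigma_algebra_measurable.
elim/big_ind : _ => [//|A B sA sB C [/sA|/sB]//|i _].
by move=> _ [B mB <-]; exact: mf.
Qed.

Lemma measurable_colvecD : measurable_fun [set: V * V] (fun p => p.1 + p.2).
Proof.
apply: measurable_fun_colvec => i; under eq_fun do rewrite mxE.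
by apply: measurable_funD; apply: (measurableT_comp (measurable_fun_coord i)).
Qed.

Lemma measurable_colvec_shift (a : V) : measurable_fun [set: V] (fun x => x + a).
Proof.
apply: measurable_fun_colvec => i; under eq_fun do rewrite mxE.
by apply: measurable_funD => //; exact: measurable_fun_coord.
Qed.

Lemma measurable_colvecZ a : measurable_fun [set: V] (fun x => a *: x).
Proof.
apply: measurable_fun_colvec => i; under eq_fun do rewrite mxE.
by apply: measurable_funM => //; exact: measurable_fun_coord.
Qed.

Lemma measurable_colvecB : measurable_fun [set: V * V] (fun p => p.1 - p.2).
Proof.
apply: measurable_fun_colvec => i; under eq_fun do rewrite !mxE.
by apply: measurable_funB; apply: (measurableT_comp (measurable_fun_coord i)).
Qed.

Lemma measurable_dotp : measurable_fun [set: V * V] (fun p => dotp p.1 p.2).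
Proof.
apply: measurable_sum => i.
by apply: measurable_funM; apply: (measurableT_comp (measurable_fun_coord i)).
Qed.

Lemma measurable_enorm : measurable_fun [set: V] enorm.
Proof.
rewrite /enorm; under eq_fun do rewrite -powR12_sqrt ?dotp_ge0//.
apply: (measurableT_comp (@measurable_powR R (2^-1))).
have mD : measurable_fun setT (fun x : V => (x, x)) by exact: measurable_fun_pair.
exact: (measurableT_comp measurable_dotp mD).
Qed.

(** The sigma-algebra is generated by the coordinates, not by the topology. An open set is a
    countable union of open cubes with rational centers and radii 1/(n+1). *)
Lemma open_measurable_colvec (D : set V) : open D -> measurable D.
Proof.
move=> oD.
pose box (k : 'cV[rat]_d * nat) : set V :=
  \bigcap_i [set y | `|y i ord0 - ratr (k.1 i ord0)| < k.2.+1%:R^-1].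
have mbox k : measurable (box k).
  apply: fin_bigcap_measurable => // i _.
  apply: measurable_set_lt => //; apply: measurableT_comp => //.
  apply: measurable_funB => //; exact: measurable_fun_coord.
(* Cubes that leave [D] are replaced by the empty set, so that the union runs over a whole countable
   type. *)
pose F k : set V := if `[< box k `<=` D >] then box k else set0.
have -> : D = \bigcup_k F k.
  apply/seteqP; split => [x Dx|x [k _]]; last first.
    by rewrite /F; case: asboolP => // kD /kD.
  have /nbhs_ballP[e/= e0 sub] : nbhs x D by exact: open_nbhs_nbhs.
  have [n ne] : exists n : nat, n.+1%:R^-1 < e / 2.
    exists (Num.truncn (e / 2)^-1); rewrite invf_plt ?posrE ?divr_gt0//.
    exact: truncnS_gt.
  have H i : exists q : rat, `|x i ord0 - ratr q| < n.+1%:R^-1.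
    have [q] := @rat_in_itvoo R (x i ord0 - n.+1%:R^-1) (x i ord0 + n.+1%:R^-1)
      (ltac:(rewrite ltrBlDr -addrA ltrDl -mulr2n pmulrn_lgt0 ?invr_gt0//)).
    by rewrite in_itv/= => qx; exists q; rewrite distrC ltr_distl.
  have [q Hq] := choice H.
  exists (\col_i q i, n) => //.
  have xb : box (\col_i q i, n) x.
    move=> i _ /=; rewrite mxE; exact: Hq.
  rewrite /F asboolT// => y yb; apply: sub; split=> // i j.
  rewrite ord1 -ball_normE/= /ball_/=.
  have /= := yb i I; rewrite mxE => yq.
  have := ler_distD (ratr (q i)) (x i ord0) (y i ord0).
  rewrite (distrC (ratr _)) => /le_lt_trans; apply.
  by rewrite [ltRHS]splitr ltrD// (lt_trans _ ne).
apply: countable_bigcupT_measurable => // k.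
by rewrite /F; case: asboolP.
Qed.

End measurable_colvec.

(** * Lebesgue measure on R^d *)

Section product_integrals.
Local Open Scope ereal_scope.
Context dT (T : measurableType dT) (R : realType).
Variable mu : {sigma_finite_measure set T -> \bar R}.

Lemma integral_tuple_measureS n (F : n.+1.-tuple T -> \bar R) :
  measurable_fun setT F -> (forall t, 0 <= F t) ->
  \int[tuple_measure mu (n := n.+1)]_t F t =
  \int[mu]_x \int[tuple_measure mu (n := n)]_t F [tuple of x :: t].
Proof.
move=> mF F0.
pose f (p : T * n.-tuple T) := [tuple of p.1 :: p.2].
have mf : measurable_fun setT f by exact: measurable_cons.
pose m : {sigma_finite_measure set (n.-tuple T) -> \bar R} :=
  tuple_measure mu (n := n).
rewrite (eq_measure_integral (pushforward (mu \x m) f)); last first.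
  move=> /= B mB _; rewrite /pushforward /product_measure1/=.
  apply: eq_integral => x _; congr (tuple_measure mu _).
  by apply/seteqP; split=> t; rewrite /xsection/= ?inE// => /set_mem.
rewrite ge0_integral_pushforward//= fubini_tonelli1//=.
exact: measurableT_comp.
Qed.

Lemma measurable_integral_cons n (F : n.+1.-tuple T -> \bar R) :
  measurable_fun setT F -> (forall t, 0 <= F t) ->
  measurable_fun setT
    (fun x => \int[tuple_measure mu (n := n)]_t F [tuple of x :: t]).
Proof.
move=> mF F0.
pose f (p : T * n.-tuple T) := [tuple of p.1 :: p.2].
have mf : measurable_fun setT f by exact: measurable_cons.
apply: (measurable_fun_fubini_tonelli_F (m2 := tuple_measure mu (n := n)) (F \o f)).
  exact: measurableT_comp.
by move=> x; exact: F0.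
Qed.

Lemma integral_tuple_prod (f : T -> R) n :
  measurable_fun setT f -> (forall x, (0 <= f x)%R) ->
  \int[tuple_measure mu (n := n)]_t (\prod_(i < n) f (tnth t i))%:E =
  (\int[mu]_x (f x)%:E) ^+ n.
Proof.
move=> mf f0; elim: n => [|n IH].
  under eq_integral do rewrite big_ord0.
  rewrite (eq_measure_integral (\d_[tuple])); last by [].
  by rewrite integral_dirac// diracT mul1e expe0.
have mp k : measurable_fun setT
    (fun t : k.-tuple T => (\prod_(i < k) f (tnth t i))%R).
  apply: measurable_prod => i _; apply: measurableT_comp => //.
  exact: measurable_tnth.
have p0 k (t : k.-tuple T) : (0 <= \prod_(i < k) f (tnth t i))%R.
  exact: prodr_ge0.
rewrite integral_tuple_measureS; last 2 first.
- by apply/measurable_EFinP; exact: mp.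
- by move=> t; rewrite lee_fin.
have I0 : 0 <= \int[mu]_x (f x)%:E by apply: integral_ge0 => x _; rewrite lee_fin.
transitivity (\int[mu]_x ((f x)%:E * (\int[mu]_x (f x)%:E) ^+ n)).
  apply: eq_integral => x _; rewrite -IH -ge0_integralZl_EFin//; last 2 first.
  - by move=> t _; rewrite lee_fin.
  - by apply/measurable_EFinP; exact: mp.
  apply: eq_integral => t _; rewrite -EFinM big_ord_recl tnth0.
  by congr (_ * _)%:E; apply: eq_bigr => i _; rewrite tnthS.
rewrite ge0_integralZr//; first by rewrite -expeS.
- exact/measurable_EFinP.
- by move=> x _; rewrite lee_fin.
- exact: expe_ge0.
Qed.

End product_integrals.

Section translation.
Local Open Scope ereal_scope.
Context {R : realType}.
Local Notation leb := (@lebesgue_measure R).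

Lemma lebesgue_measure_shift (a : R) (B : set R) : measurable B ->
  pushforward leb ((fun x => (x + a)%R) : _ -> measurableTypeR R) B = leb B.
Proof.
move=> mB; apply/esym/lebesgue_measure_unique => //.
  by apply: measurable_funD.
move=> ? _ [[b c]] _ <-; rewrite /= /pushforward.
rewrite (_ : _ @^-1` _ = [set` `](b - a)%R, (c - a)%R]]); last first.
  by apply/seteqP; split=> x /=; rewrite !in_itv/= ltrBlDr lerBrDr.
by rewrite !lebesgue_measure_itv/= !lte_fin ltrD2r -!EFinB opprB addrA subrK.
Qed.

Lemma integral_shift (a : R) (f : R -> \bar R) :
  measurable_fun setT f -> (forall x, 0 <= f x) ->
  \int[leb]_x f (x + a)%R = \int[leb]_x f x.
Proof.
move=> mf f0; transitivity
  (\int[pushforward leb ((fun x => (x + a)%R) : _ -> measurableTypeR R)]_x f x).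
  by rewrite ge0_integral_pushforward//; exact: measurable_funD.
apply: eq_measure_integral => //=; first exact: measurable_funD.
by move=> _ B mB _; exact: lebesgue_measure_shift.
Qed.

Lemma integral_tuple_shift n (a : 'I_n -> R)
    (F : n.-tuple (measurableTypeR R) -> \bar R) :
  measurable_fun setT F -> (forall t, 0 <= F t) ->
  \int[tuple_measure leb (n := n)]_t F [tuple (tnth t i + a i)%R | i < n] =
  \int[tuple_measure leb (n := n)]_t F t.
Proof.
elim: n a F => [|n IH] a F mF F0.
  by apply: eq_integral => t _; congr F; apply: eq_from_tnth => -[].
have ms : measurable_fun setT (fun t : n.+1.-tuple (measurableTypeR R) =>
    [tuple (tnth t i + a i)%R | i < n.+1]).
  apply/measurable_fun_tnthP => i.
  rewrite (_ : _ \o _ = fun t : n.+1.-tuple (measurableTypeR R) => (tnth t i + a i)%R); last first.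
    by apply/funext => t /=; rewrite tnth_mktuple.
  apply: measurable_funD => //; exact: (measurable_tnth (T := measurableTypeR R)).
rewrite [LHS]integral_tuple_measureS//; last exact: (measurableT_comp mF ms).
rewrite [RHS]integral_tuple_measureS//.
rewrite -[RHS](integral_shift (a ord0)); last 2 first.
- exact: (@measurable_integral_cons _ _ _ leb n F).
- by move=> x; exact: integral_ge0.
apply: eq_integral => x _.
rewrite -[RHS](IH (fun i => a (lift ord0 i))); last 2 first.
- apply: measurableT_comp => //; apply: measurable_cons => //.
- by [].
apply: eq_integral => t _; congr F; apply: eq_from_tnth => i.
rewrite tnth_mktuple; case: (unliftP ord0 i) => [j|] ->; last by rewrite !tnth0.
by rewrite !tnthS tnth_mktuple.
Qed.

End translation.

Section lebesgue_colvec.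
Local Open Scope ereal_scope.
Context {R : realType} {d : nat}.
Local Notation V := 'cV[R]_d.
Local Notation lam := (@lebesgue_cV R d).

Lemma integral_lebesgue_cV (F : V -> \bar R) :
  measurable_fun setT F -> (forall x, 0 <= F x) ->
  \int[lam]_x F x =
  \int[tuple_measure lebesgue_measure (n := d)]_t F (colvec_of_tuple t).
Proof.
move=> mF F0; rewrite -(ge0_integral_pushforward
  (@measurable_colvec_of_tuple R d) (tuple_measure lebesgue_measure (n := d)) measurableT)//.
Qed.

Lemma integral_lebesgue_cV_prod (f : R -> R) :
  measurable_fun setT f -> (forall x, (0 <= f x)%R) ->
  \int[lam]_x (\prod_(i < d) f (x i ord0))%:E =
  (\int[lebesgue_measure]_x (f x)%:E) ^+ d.
Proof.
move=> mf f0; rewrite integral_lebesgue_cV; last 2 first.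
- apply/measurable_EFinP; apply: measurable_prod => i _.
  by apply: measurableT_comp => //; exact: measurable_fun_coord.
- by move=> x; rewrite lee_fin prodr_ge0.
rewrite -integral_tuple_prod//; apply: eq_integral => t _.
by congr (_%:E); apply: eq_bigr => i _; rewrite mxE.
Qed.

Lemma integral_lebesgue_cV_shift (a : V) (F : V -> \bar R) :
  measurable_fun setT F -> (forall x, 0 <= F x) ->
  \int[lam]_x F (x + a)%R = \int[lam]_x F x.
Proof.
move=> mF F0; rewrite !integral_lebesgue_cV//; last first.
  exact: (measurableT_comp mF (measurable_colvec_shift a)).
rewrite -[RHS](integral_tuple_shift (fun i => a i ord0)) //; last first.
  apply: measurableT_comp => //; exact: measurable_colvec_of_tuple.
apply: eq_integral => t _; congr F; apply/matrixP => i j.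
by rewrite !mxE tnth_mktuple ord1.
Qed.

End lebesgue_colvec.

Section linear_images.
Local Open Scope ereal_scope.
Context {R : realType} {d : nat}.
Local Notation V := 'cV[R]_d.
Local Notation lam := (@lebesgue_cV R d).

(* Uniqueness of Haar measure: evaluate
   [\int\int \1_A (x + y) * \1_B y] against [lam] and its image under [T] in
   both orders. *)
Lemma lebesgue_cV_preimage_additive (T T' : V -> V) (A B : set V) :
  {morph T : x y / (x + y)%R} -> measurable_fun setT T ->
  measurable_fun setT T' -> cancel T T' -> cancel T' T ->
  measurable A -> measurable B -> (forall x, B x -> B (- x)%R) ->
  lam A * lam (T @^-1` B) = lam (T @^-1` A) * lam B.
Proof.
move=> TD mT mT' TK T'K mA mB BN.
have [q qE] := sigma_finite_pushforward (sigma_finiteT lam) mT mT' TK.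
have qE' C : q C = lam (T @^-1` C) by rewrite -qE.
rewrite -!qE'.
have iq F : measurable_fun setT F -> (forall x, 0 <= F x) ->
    \int[q]_x F x = \int[lam]_x F (T x).
  move=> mF F0; rewrite (eq_measure_integral (pushforward lam T)); last first.
    by move=> C _ _; rewrite -qE.
  by rewrite ge0_integral_pushforward.
(* The image measure is again translation invariant: by additivity, a shift by [a] after [T] is a
   shift by [T' a] before it. *)
have qshift a F : measurable_fun setT F -> (forall x, 0 <= F x) ->
    \int[q]_x F (x + a)%R = \int[q]_x F x.
  move=> mF F0; rewrite !iq//; last first.
    exact: (measurableT_comp mF (measurable_colvec_shift a)).
  rewrite -[RHS](integral_lebesgue_cV_shift (T' a)) => [|//|//]; last first.
    exact: measurableT_comp.
  by apply: eq_integral => x _; rewrite TD T'K.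
have mI (C : set V) : measurable C -> measurable_fun setT (\1_C : V -> R).
  by move=> mC; exact: measurable_indic.
have mAD : measurable_fun setT (fun p : V * V => \1_A (p.1 + p.2)%R : R).
  exact: (measurableT_comp (mI _ mA) measurable_colvecD).
have mBB : measurable_fun setT (fun p : V * V => \1_B (p.1 - p.2)%R : R).
  exact: (measurableT_comp (mI _ mB) measurable_colvecB).
have BC x y : \1_B (x - y)%R = \1_B (y - x)%R :> R.
  rewrite !indicE; congr (_%:R); congr nat_of_bool; apply/idP/idP; rewrite !inE.
    by move/BN; rewrite opprB.
  by move/BN; rewrite opprB.
transitivity (\int[q]_y \int[lam]_x (\1_A (x + y)%R * \1_B y)%:E).
  transitivity (\int[q]_y (lam A * (\1_B y)%:E)).
    rewrite ge0_integralZl//; last by apply/measurable_EFinP; exact: mI.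
    by rewrite integral_indic// setIT.
  apply: eq_integral => y _; under [RHS]eq_integral do rewrite EFinM.
  rewrite ge0_integralZr//; last first.
    apply/measurable_EFinP.
    exact: (measurableT_comp (mI _ mA) (measurable_colvec_shift y)).
  congr (_ * _).
  rewrite (integral_lebesgue_cV_shift y (F := fun x => (\1_A x)%:E))//.
    by rewrite integral_indic// setIT.
  by apply/measurable_EFinP; exact: mI.
transitivity (\int[lam]_x \int[q]_y (\1_A (x + y)%R * \1_B y)%:E).
  rewrite (fubini_tonelli (m1 := q) (m2 := lam)
    (fun p => (\1_A (p.2 + p.1)%R * \1_B p.1)%:E))//.
  apply/measurable_EFinP; apply: measurable_funM.
    under eq_fun do rewrite addrC; exact: mAD.
  exact: (measurableT_comp (mI _ mB)).
transitivity (\int[lam]_x \int[q]_y (\1_A y * \1_B (y - x)%R)%:E).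
  apply: eq_integral => x _.
  rewrite -[RHS](qshift x (fun y => (\1_A y * \1_B (y - x)%R)%:E))//.
    by apply: eq_integral => y _; rewrite addrK addrC.
  apply/measurable_EFinP; apply: measurable_funM; first exact: mI.
  exact: (measurableT_comp (mI _ mB) (measurable_colvec_shift (- x))).
rewrite (fubini_tonelli (m1 := lam) (m2 := q)
    (fun p => (\1_A p.2 * \1_B (p.2 - p.1)%R)%:E))//=; last first.
  apply/measurable_EFinP; apply: measurable_funM.
    exact: (measurableT_comp (mI _ mA)).
  under eq_fun do rewrite BC; exact: mBB.
transitivity (\int[q]_y ((\1_A y)%:E * lam B)).
  apply: eq_integral => y _; under eq_integral do rewrite EFinM BC.
  rewrite ge0_integralZl//; last first.
    apply/measurable_EFinP.
    exact: (measurableT_comp (mI _ mB) (measurable_colvec_shift (- y))).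
  rewrite (integral_lebesgue_cV_shift (- y)%R (F := fun x => (\1_B x)%:E))//.
    by rewrite integral_indic// setIT.
  by apply/measurable_EFinP; exact: mI.
rewrite ge0_integralZr//; last by apply/measurable_EFinP; exact: mI.
by rewrite integral_indic// setIT.
Qed.

(** A sup-norm ball is a product set, so its volume is explicit. It serves to bound Euclidean balls
    on both sides and as the symmetric test set for dilations. *)
Definition cube (a : R) : set V := [set x | forall i, (`|x i ord0| <= a)%R].

Lemma cubeE a x : (\1_(cube a) x = \prod_(i < d) \1_`[(- a)%R, a]%classic (x i ord0) :> R)%R.
Proof.
rewrite indicE; have [xa|xa] := boolP (x \in cube a).
  rewrite big1// => i _; rewrite indicE mem_set//= in_itv/= -ler_norml.
  by move: xa; rewrite inE.
have : ~ cube a x by move: xa; rewrite notin_setE.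
move=> /existsNP[i xi]; rewrite (bigD1 i)//= indicE memNset ?mul0r//=.
by rewrite in_itv/= -ler_norml.
Qed.

Lemma measurable_cube a : measurable (cube a).
Proof.
apply/(@measurable_indicP _ _ R); rewrite (funext (cubeE a)).
apply: measurable_prod => i _.
have m1 : measurable_fun setT (\1_`[(- a)%R, a]%classic : R -> R) by exact: measurable_indic.
exact: (measurableT_comp m1 (measurable_fun_coord i)).
Qed.

Lemma lebesgue_cV_cube a : (0 <= a)%R -> lam (cube a) = ((2 * a) ^+ d)%:E.
Proof.
move=> a0; rewrite -[cube a]setIT -integral_indic//; last exact: measurable_cube.
under eq_integral do rewrite cubeE.
rewrite integral_lebesgue_cV_prod//.
have leba : lebesgue_measure `[(- a)%R, a]%classic = (2 * a)%:E.
  rewrite lebesgue_measure_itv/= lte_fin.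
  case: ltP => [_|aa]; first by rewrite -EFinB; congr (_%:E); ring.
  by congr (_%:E); lra.
by rewrite integral_indic// setIT EFin_expe; congr (_ ^+ _).
Qed.

Lemma sub_eball_cube r : eball r `<=` cube r.
Proof. by move=> x /= xr i; rewrite (le_trans (coord_le_enorm _ _))// ltW. Qed.

Lemma open_eball r : open (@eball R d r).
Proof.
apply/open_eballP => x /= xr; exists (r - enorm x)%R; first by rewrite subr_gt0.
move=> y; rewrite ltrBrDr => xy /=; apply: le_lt_trans xy.
by have := ler_enormD (y - x) x; rewrite subrK enorm_distC.
Qed.

Lemma measurable_eball r : measurable (@eball R d r).
Proof. by apply: open_measurable_colvec; exact: open_eball. Qed.

Lemma lebesgue_cV_eball_ltey r : lam (eball r) < +oo.
Proof.
have [r0|r0] := leP 0%R r.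
  rewrite (@le_lt_trans _ _ (lam (cube r)))//.
    apply: le_measure; rewrite ?inE; [exact: measurable_eball|exact: measurable_cube|].
    exact: sub_eball_cube.
  by rewrite lebesgue_cV_cube// ltry.
rewrite (_ : eball r = set0) ?measure0//.
by apply/seteqP; split=> x //=; rewrite /eball/= => xr; have := enorm_ge0 x; lra.
Qed.

Lemma lebesgue_cV_eball_gt0 r : (0 < r)%R -> 0 < lam (eball r).
Proof.
(* A point of this cube has coordinates summing in absolute value to at most r d/(d+1), which is
   strictly below r. *)
move=> r0; apply: (@lt_le_trans _ _ (lam (cube (r / d.+1%:R)))).
  by rewrite lebesgue_cV_cube ?lte_fin ?exprn_gt0 ?mulr_gt0 ?divr_ge0 ?divr_gt0// ltW.
apply: le_measure; rewrite ?inE; [exact: measurable_cube|exact: measurable_eball|].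
move=> x xr /=; apply: (@le_lt_trans _ _ (\sum_(i < d) r / d.+1%:R)%R).
  by rewrite (le_trans (enorm_le_sum _))// ler_sum.
rewrite big_const iter_addr addr0 card_ord -[(r / d.+1%:R *+ d)%R]mulr_natr -mulrA gtr_pMr//.
by rewrite mulrC ltr_pdivrMr// mul1r ltr_nat.
Qed.

(** With the unit ball as symmetric test set, the Haar identity has the same factor on both sides,
    since the ball is its own preimage; its volume is positive and finite, so it cancels. *)
Lemma lebesgue_cV_isometry (T T' : V -> V) (A : set V) :
  {morph T : x y / (x + y)%R} -> measurable_fun setT T ->
  measurable_fun setT T' -> cancel T T' -> cancel T' T ->
  (forall x, enorm (T x) = enorm x) -> measurable A ->
  lam (T @^-1` A) = lam A.
Proof.
move=> TD mT mT' TK T'K Tn mA.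
have := lebesgue_cV_preimage_additive TD mT mT' TK T'K mA (measurable_eball 1).
have eN x : eball 1 x -> @eball R d 1 (- x)%R by rewrite /eball/= enormN.
move=> /(_ eN).
rewrite (_ : T @^-1` eball 1 = eball 1); last by apply/seteqP; split=> x; rewrite /eball/= Tn.
have b0 := @lebesgue_cV_eball_gt0 1%R ltr01.
have bf : lam (eball 1) \is a fin_num by rewrite ge0_fin_numE// lebesgue_cV_eball_ltey.
rewrite -(fineK bf) in b0 *; rewrite lte_fin in b0.
move=> /(congr1 (fun u => u * (fine (lam (eball 1)))^-1%:E)).
by rewrite -!muleA -!EFinM divff ?gt_eqF// !mule1 => ->.
Qed.

(** The dilated set is the preimage of [A] under division by [r]; testing against the unit cube,
    whose preimage is [cube r], gives the factor. *)
Lemma lebesgue_cV_scale (r : R) (A : set V) : (0 < r)%R -> measurable A ->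
  lam [set r *: x | x in A] = (r ^+ d)%:E * lam A.
Proof.
move=> r0 mA; pose T (x : V) := (r^-1 *: x)%R.
have rn : r != 0%R by rewrite gt_eqF.
have -> : [set r *: x | x in A] = T @^-1` A.
  apply/seteqP; split=> [_ [x Ax <-]|x Ax]; first by rewrite /T /= scalerA mulVf// scale1r.
  by exists (T x) => //; rewrite /T scalerA mulfV// scale1r.
have TK : cancel T (fun x : V => r *: x)%R.
  by move=> x; rewrite /T scalerA mulfV// scale1r.
have T'K : cancel (fun x : V => r *: x)%R T.
  by move=> x; rewrite /T scalerA mulVf// scale1r.
have TD : {morph T : x y / (x + y)%R} by move=> x y; rewrite /T scalerDr.
have cN x : cube 1 x -> cube 1 (- x)%R by move=> xc i; rewrite mxE normrN; exact: xc.
have := lebesgue_cV_preimage_additive TD (@measurable_colvecZ _ _ (r^-1)%R)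
  (@measurable_colvecZ _ _ r) TK T'K mA (measurable_cube 1) cN.
rewrite (_ : T @^-1` cube 1 = cube r); last first.
  apply/seteqP; split=> x xc i; have := xc i; rewrite mxE normrM normfV (gtr0_norm r0);
  by rewrite mulrC ler_pdivrMr// mul1r.
rewrite !lebesgue_cV_cube ?ltW// mulr1 exprMn EFinM.
have p0 : (0 < 2 ^+ d :> R)%R by rewrite exprn_gt0.
move=> /(congr1 (fun u => u * ((2 ^+ d)^-1)%:E)).
rewrite -!muleA -!EFinM mulfV ?gt_eqF// mule1 => <-.
by rewrite muleC mulrCA mulfV ?gt_eqF// mulr1.
Qed.

End linear_images.

(** Continuity of the power along e = 1/(k+1). It brings the volume of a closed ball down to that of
    the open one. *)
Lemma ler_pow_addgt0 (R : realType) (x r w : R) n :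
  (forall e, 0 < e -> x <= (r + e) ^+ n * w) -> x <= r ^+ n * w.
Proof.
move=> H; have cu : (fun k => (r + k.+1%:R^-1) ^+ n * w) @ \oo --> r ^+ n * w.
  apply: cvgM; last exact: cvg_cst.
  have ch : (fun k => r + k.+1%:R^-1 : R) @ \oo --> r.
    rewrite -[X in _ --> X]addr0; apply: cvgD; first exact: cvg_cst.
    exact: cvg_harmonic.
  exact: (cvg_comp _ _ ch (@exprn_continuous _ n r)).
rewrite -(cvg_lim _ cu)//; apply: limr_ge; first by apply/cvg_ex; eexists; exact: cu.
by apply: nearW => k; apply: H.
Qed.

(** * Volume of balls *)

Section ball_volume.
Local Open Scope ereal_scope.
Context {R : realType} {d : nat} (d_gt0 : (0 < d)%N).
Local Notation V := 'cV[R]_d.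
Local Notation lam := (@lebesgue_cV R d).
Local Notation leb := (@lebesgue_measure R).

Definition unit_ball_volume : R := fine (lam (eball 1)).

Lemma unit_ball_volumeE : lam (eball 1) = unit_ball_volume%:E.
Proof. by rewrite fineK// ge0_fin_numE// lebesgue_cV_eball_ltey. Qed.

Lemma unit_ball_volume_gt0 : (0 < unit_ball_volume)%R.
Proof. by rewrite -lte_fin -unit_ball_volumeE lebesgue_cV_eball_gt0. Qed.

Lemma lebesgue_cV_eball r : (0 <= r)%R ->
  lam (eball r) = (r ^+ d * unit_ball_volume)%:E.
Proof.
rewrite le_eqVlt => /predU1P[<-|r0].
  rewrite expr0n gtn_eqF//= mul0r (_ : eball 0 = set0) ?measure0//.
  by apply/seteqP; split=> x //; rewrite /eball/= ltNge enorm_ge0.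
rewrite EFinM -unit_ball_volumeE -lebesgue_cV_scale//; last exact: measurable_eball.
congr (lam _); apply/seteqP; split=> [x|_ [x x1 <-]]; rewrite /eball/=.
  move=> xr; exists (r^-1 *: x)%R; last by rewrite scalerA mulfV ?gt_eqF// scale1r.
  by rewrite /eball/= enormZ gtr0_norm ?invr_gt0// mulrC ltr_pdivrMr// mul1r.
by move: x1; rewrite /eball/= enormZ gtr0_norm// gtr_pMr.
Qed.

Lemma measurable_cball (r : R) : measurable [set x : V | (enorm x <= r)%R].
Proof. by apply: measurable_set_le => //; exact: measurable_enorm. Qed.

Lemma lebesgue_cV_cball r : (0 <= r)%R ->
  lam [set x | (enorm x <= r)%R] = (r ^+ d * unit_ball_volume)%:E.
Proof.
move=> r0.
have le1 e : (0 < e)%R -> lam [set x | (enorm x <= r)%R] <= ((r + e) ^+ d * unit_ball_volume)%:E.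
  move=> e0; rewrite -lebesgue_cV_eball; last by rewrite addr_ge0// ltW.
  apply: le_measure; rewrite ?inE; [exact: measurable_cball|exact: measurable_eball|].
  by move=> x; rewrite /eball/= => xr; rewrite (le_lt_trans xr)// ltrDl.
have fr : lam [set x | (enorm x <= r)%R] \is a fin_num.
  by rewrite ge0_fin_numE// (le_lt_trans (le1 1%R _))// ltry.
apply/eqP; rewrite eq_le; apply/andP; split; last first.
  rewrite -lebesgue_cV_eball//; apply: le_measure; rewrite ?inE;
    [exact: measurable_eball|exact: measurable_cball|].
  by move=> x; rewrite /eball/= => /ltW.
rewrite -(fineK fr) lee_fin; apply: ler_pow_addgt0 => e e0.
by rewrite -lee_fin fineK// le1.
Qed.

Lemma lebesgue_cV_sphere r : (0 <= r)%R -> lam [set x | enorm x = r] = 0.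
Proof.
move=> r0; have -> : [set x : V | enorm x = r] = [set x | (enorm x <= r)%R] `\` eball r.
  apply/seteqP; split=> x; rewrite /eball/=; first by move=> ->; rewrite lexx ltxx.
  by move=> [xr] /negP; rewrite -leNgt => rx; apply/eqP; rewrite eq_le xr.
rewrite measureD/=; [|exact: measurable_cball|exact: measurable_eball|].
  rewrite setIidr; last by move=> x; rewrite /eball/= => /ltW.
  by rewrite lebesgue_cV_cball// lebesgue_cV_eball// subee.
by rewrite lebesgue_cV_cball// ltry.
Qed.

(** Writes exp(-a) as an integral over levels t >= a, ready for Tonelli. After a shift by [a] it is
    the total mass of the exponential density of rate 1. *)
Lemma integral_exp_tail (a : R) :
  \int[leb]_t (\1_`[a, +oo[%classic t * expR (- t))%:E = (expR (- a))%:E.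
Proof.
have mf : measurable_fun setT (fun t : R => \1_`[a, +oo[%classic t * expR (- t))%R.
  apply: measurable_funM; first exact: measurable_indic.
  by apply: measurableT_comp => //; exact: measurable_expR.
rewrite -(integral_shift a (f := fun t => (\1_`[a, +oo[%classic t * expR (- t))%:E)); last 2 first.
- by apply/measurable_EFinP.
- by move=> x; rewrite lee_fin mulr_ge0// expR_ge0.
have me : measurable_fun setT (fun t : R => (exponential_pdf 1 t)%:E).
  by apply/measurable_EFinP; exact: measurable_exponential_pdf.
transitivity (\int[leb]_t ((expR (- a))%:E * (exponential_pdf 1 t)%:E)).
  apply: eq_integral => t _; rewrite -EFinM; congr (_%:E).
  rewrite /exponential_pdf patchE indicE mem_setE in_itv/= andbT lerDr.
  rewrite mem_setE in_itv/= andbT; case: ifP => _; last by rewrite mul0r mulr0.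
  by rewrite !mul1r mulN1r opprD expRD mulrC.
rewrite ge0_integralZl_EFin ?expR_ge0//; last first.
  by move=> t _; rewrite lee_fin exponential_pdf_ge0.
by rewrite integral_exponential_pdf// mule1.
Qed.

Lemma integral_gauss_cV :
  \int[lam]_x (expR (- enorm x ^+ 2))%:E = (pi `^ (d%:R / 2))%:E.
Proof.
transitivity (\int[lam]_x (\prod_(i < d) gauss_fun (x i ord0))%:E).
  apply: eq_integral => x _; congr (_%:E); rewrite enorm_sqr /dotp -sumrN.
  by rewrite (big_morph _ (@expRD R) (expR0 R)); apply: eq_bigr => i _; rewrite /gauss_fun expr2.
rewrite integral_lebesgue_cV_prod; last 2 first.
- exact: measurable_gauss_fun.
- exact: gauss_fun_ge0.
rewrite integralT_gauss -EFin_expe -powR12_sqrt ?pi_ge0// -powR_mulrn ?powR_ge0//.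
by rewrite -powRrM mulrC.
Qed.

(** After the exchange of integrals, the slice at level t > 0 is a closed ball of radius sqrt(t),
    whose volume is t^(d/2) times that of the unit ball; weighting by exp(-t) produces Gamma(d/2 +
    1). *)
Lemma unit_ball_volume_Gamma :
  (unit_ball_volume * Gamma (d%:R / 2 + 1) = pi `^ (d%:R / 2) :> R)%R.
Proof.
have mE : measurable_fun setT (fun t : R => expR (- t)).
  by apply: measurableT_comp => //; exact: measurable_expR.
pose G := \int[leb]_(t in `]0%R, +oo[) (t `^ (d%:R / 2 + 1 - 1) * expR (- t))%:E.
have G0 : 0 <= G by apply: integral_ge0 => t _; rewrite lee_fin mulr_ge0 ?powR_ge0 ?expR_ge0.
suff key : unit_ball_volume%:E * G = (pi `^ (d%:R / 2))%:E.
  (* Finiteness of the Gamma integral is read off the identity itself: an infinite [G] times a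
     positive volume would be infinite. *)
  have Gf : G \is a fin_num.
    rewrite ge0_fin_numE// ltey; apply/eqP => Gy; move: key; rewrite Gy.
    by rewrite gt0_muley// lte_fin unit_ball_volume_gt0.
  have -> : Gamma (d%:R / 2 + 1) = fine G by [].
  by move: key; rewrite -{1}(fineK Gf) -EFinM => -[].
rewrite -integral_gauss_cV.
under [RHS]eq_integral do rewrite -integral_exp_tail.
have mp : measurable_fun setT (fun p : V * R =>
    (\1_`[enorm p.1 ^+ 2, +oo[%classic p.2 * expR (- p.2))%R).
  apply: measurable_funM; last exact: (measurableT_comp mE).
  rewrite (_ : (fun _ => _) = \1_[set p : V * R | (enorm p.1 ^+ 2 <= p.2)%R]); last first.
    apply/funext => p; rewrite !indicE; congr (_%:R); congr nat_of_bool.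
    by apply/idP/idP; rewrite !inE/= in_itv/= andbT.
  apply: measurable_indic; apply: measurable_set_le => //.
  apply: measurable_funX; exact: (measurableT_comp measurable_enorm).
rewrite (fubini_tonelli (m1 := lam) (m2 := leb)
  (fun p : V * R => (\1_`[enorm p.1 ^+ 2, +oo[%classic p.2 * expR (- p.2))%:E)); last 2 first.
- exact/measurable_EFinP.
- by move=> p; rewrite lee_fin mulr_ge0// expR_ge0.
rewrite /= /G integral_mkcond -ge0_integralZl_EFin//; last 3 first.
- move=> t _; apply: erestrict_ge0 => {}t _.
  by rewrite lee_fin mulr_ge0 ?powR_ge0 ?expR_ge0.
- apply/(measurable_restrictT _ _).1 => //; apply/measurable_EFinP.
  apply: measurable_funM; first by apply: measurable_funTS; exact: measurable_powR.
  exact: measurable_funTS.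
- exact/ltW/unit_ball_volume_gt0.
apply: eq_integral => t _.
under [RHS]eq_integral do rewrite EFinM.
have ind (x : V) : (\1_`[enorm x ^+ 2, +oo[%classic t =
    \1_[set x : V | (enorm x ^+ 2 <= t)%R] x :> R)%R.
  rewrite !indicE; congr (_%:R); congr nat_of_bool.
  by apply/idP/idP; rewrite !inE/= in_itv/= andbT.
under [RHS]eq_integral do rewrite ind.
have mS : measurable [set x : V | (enorm x ^+ 2 <= t)%R].
  apply: measurable_set_le => //; apply: measurable_funX; exact: measurable_enorm.
rewrite ge0_integralZr ?lee_fin ?expR_ge0//; last first.
  by apply/measurable_EFinP; exact: measurable_indic.
rewrite integral_indic// setIT patchE mem_setE in_itv/= andbT.
have [t0|t0] := ltP 0%R t.
  rewrite (_ : [set x | _] = [set x | (enorm x <= Num.sqrt t)%R]); last first.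
    apply/seteqP; split=> x /=.
      by rewrite -{2}(ger0_norm (enorm_ge0 x)) -sqrtr_sqr ler_sqrt// ltW.
    rewrite -{1}(ger0_norm (enorm_ge0 x)) -sqrtr_sqr ler_sqrt// ltW//.
  rewrite lebesgue_cV_cball ?sqrtr_ge0// -!EFinM; congr (_%:E).
  rewrite addrK -powR12_sqrt ?ltW// -powR_mulrn ?powR_ge0// -powRrM.
  by rewrite (mulrC (2^-1)%R) mulrA (mulrC unit_ball_volume).
rewrite mule0; have -> : lam [set x | (enorm x ^+ 2 <= t)%R] = 0; last by rewrite mul0e.
apply/eqP; rewrite eq_le measure_ge0 andbT.
apply: (@le_trans _ _ (lam [set x | (enorm x <= 0)%R])).
  apply: le_measure; rewrite ?inE; [exact: mS|exact: measurable_cball|].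
  move=> x /= xt; have := le_trans xt t0; rewrite le_eqVlt ltNge sqr_ge0 orbF.
  by rewrite sqrf_eq0 => /eqP ->.
by rewrite lebesgue_cV_cball// expr0n gtn_eqF//= mul0r.
Qed.

(** Turns the radius r_d into the d-th root of the volume divided by the unit ball volume. That
    Gamma does not vanish follows from the preceding product formula. *)
Lemma sphere_areaE : (sphere_area d = d%:R * unit_ball_volume :> R)%R.
Proof.
have G0 : Gamma (d%:R / 2 + 1) != 0%R :> R.
  apply/eqP => G0; have := unit_ball_volume_Gamma; rewrite G0 mulr0 => /esym/eqP.
  by rewrite gt_eqF// powR_gt0// pi_gt0.
by rewrite /sphere_area -unit_ball_volume_Gamma -!mulrA divff// mulr1.
Qed.

End ball_volume.

(** * Polarization *)

Section invariant_integrals.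
Local Open Scope ereal_scope.
Context dT (T : measurableType dT) (R : realType).
Variables (mu : {measure set T -> \bar R}) (s : T -> T).
Hypothesis ms : measurable_fun setT s.
Hypothesis inv : forall F : T -> \bar R, measurable_fun setT F ->
  (forall x, 0 <= F x) -> \int[mu]_x F (s x) = \int[mu]_x F x.

Lemma integral_add_invariant (g : T -> R) :
  measurable_fun setT g -> (forall x, (0 <= g x)%R) ->
  \int[mu]_x (g x + g (s x))%:E = \int[mu]_x (g x)%:E + \int[mu]_x (g x)%:E.
Proof.
move=> mg g0; under eq_integral do rewrite EFinD.
have mgs : measurable_fun setT (fun x => g (s x)) by exact: measurableT_comp.
rewrite ge0_integralD//=; last 4 first.
- by move=> x _; rewrite lee_fin.
- exact/measurable_EFinP.
- by move=> x _; rewrite lee_fin.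
- exact/measurable_EFinP.
congr (_ + _); apply: (inv (F := EFin \o g)) => [|x]; last by rewrite lee_fin.
exact/measurable_EFinP.
Qed.

(** A pointwise inequality is needed only for sums over the pairs {x, s x}: each sum integrates to
    twice the integral. Polarization inequalities hold only in this summed form. *)
Lemma le_integral_invariant (g h : T -> R) :
  measurable_fun setT g -> measurable_fun setT h ->
  (forall x, (0 <= g x)%R) -> (forall x, (0 <= h x)%R) ->
  (forall x, (g x + g (s x) <= h x + h (s x))%R) ->
  \int[mu]_x (g x)%:E <= \int[mu]_x (h x)%:E.
Proof.
move=> mg mh g0 h0 gh.
have : \int[mu]_x (g x + g (s x))%:E <= \int[mu]_x (h x + h (s x))%:E.
  apply: ge0_le_integral => //.
  - by move=> x _; rewrite lee_fin addr_ge0.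
  - by apply/measurable_EFinP; apply: measurable_funD => //; exact: measurableT_comp.
  - by apply/measurable_EFinP; apply: measurable_funD => //; exact: measurableT_comp.
  - by move=> x _; rewrite lee_fin.
rewrite !integral_add_invariant//.
have : 0 <= \int[mu]_x (g x)%:E by apply: integral_ge0 => x _; rewrite lee_fin.
have : 0 <= \int[mu]_x (h x)%:E by apply: integral_ge0 => x _; rewrite lee_fin.
case: (\int[mu]_x (h x)%:E) => [b| |] //; case: (\int[mu]_x (g x)%:E) => [a| |] //= _ _.
  by rewrite -!EFinD !lee_fin => ab; lra.
by move=> _; rewrite leey.
Qed.

End invariant_integrals.

Section reflection.
Context {R : realType} {d : nat}.
Local Notation V := 'cV[R]_d.
Local Notation lam := (@lebesgue_cV R d).
Implicit Types (e x y z : V) (h : R).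

(** For a unit [e], the signed distance from [z] to the hyperplane of equation [dotp z e = h]. *)
Definition level_dist e h z : R := dotp z e - h.

Definition reflection e h z : V := z - (2 * level_dist e h z) *: e.

(** The larger value goes to the side where [level_dist] is nonpositive, which is the side of the
    origin when [h > 0]. *)
Definition polarization e h (f : V -> R) z : R :=
  if level_dist e h z <= 0 then Num.max (f z) (f (reflection e h z))
  else Num.min (f z) (f (reflection e h z)).

Lemma measurable_level_dist e h : measurable_fun setT (level_dist e h).
Proof.
apply: measurable_funB => //; apply: measurable_sum => i.
by apply: measurable_funM => //; exact: measurable_fun_coord.
Qed.

Lemma measurable_reflection e h : measurable_fun setT (reflection e h).
Proof.
apply: measurable_fun_colvec => i; under eq_fun do rewrite !mxE.
apply: measurable_funB; first exact: measurable_fun_coord.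
by apply: measurable_funM => //; apply: measurable_funM => //; exact: measurable_level_dist.
Qed.

Lemma measurable_polarization e h f :
  measurable_fun setT f -> measurable_fun setT (polarization e h f).
Proof.
move=> mf; have mfr : measurable_fun setT (fun z => f (reflection e h z)).
  exact: (measurableT_comp mf (measurable_reflection e h)).
apply: measurable_fun_ifT.
- apply: measurable_fun_ler => //; exact: measurable_level_dist.
- exact: measurable_maxr.
- exact: measurable_minr.
Qed.

Section unit_normal.
Variables (e : V) (h : R).
Hypothesis e1 : dotp e e = 1.
Local Notation l := (level_dist e h).
Local Notation s := (reflection e h).

Lemma level_dist_reflection z : l (s z) = - l z.
Proof. by rewrite {1}/level_dist /reflection !dotpE e1 mulr1 /level_dist; ring. Qed.

Lemma reflectionK : involutive s.
Proof.
move=> z; rewrite {1}/reflection level_dist_reflection /reflection.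
by rewrite mulrN scaleNr opprK subrK.
Qed.

Lemma reflection_fix z : l z = 0 -> s z = z.
Proof. by move=> lz; rewrite /reflection lz mulr0 scale0r subr0. Qed.

Lemma enorm_reflectionB x y : enorm (s x - s y) = enorm (x - y).
Proof.
rewrite /enorm; congr Num.sqrt; rewrite /reflection /level_dist !dotpE e1.
by rewrite (dotpC y x) !(dotpC e); ring.
Qed.

Lemma enorm_reflectionBr x y : enorm (x - s y) = enorm (s x - y).
Proof. by rewrite -enorm_reflectionB reflectionK. Qed.

(** The sign of [l x * l y] decides everything: reflecting one point of a pair moves it away from
    the other when both lie on the same side, and closer when they lie on opposite sides. *)
Lemma sqr_enorm_reflectionB x y :
  enorm (x - s y) ^+ 2 = enorm (x - y) ^+ 2 + 4 * (l x * l y).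
Proof.
rewrite !enorm_sqr /reflection /level_dist !dotpE e1.
by rewrite (dotpC y x) !(dotpC e); ring.
Qed.

(** For [h > 0], the member of {z, s z} nearer to the origin is the one with nonpositive
    [level_dist]. This controls the support radius and the second moment. *)
Lemma sqr_enorm_reflection z : enorm (s z) ^+ 2 = enorm z ^+ 2 - 4 * h * l z.
Proof.
rewrite !enorm_sqr /reflection /level_dist !dotpE e1.
by rewrite !(dotpC e); ring.
Qed.

Lemma le_enorm_reflectionB x y : 0 <= l x * l y ->
  enorm (x - y) <= enorm (x - s y).
Proof.
move=> lxy; rewrite -(@ler_pXn2r _ 2) ?nnegrE ?enorm_ge0//.
by rewrite sqr_enorm_reflectionB lerDl mulr_ge0.
Qed.

Lemma ge_enorm_reflectionB x y : l x * l y <= 0 ->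
  enorm (x - s y) <= enorm (x - y).
Proof.
move=> lxy; rewrite -(@ler_pXn2r _ 2) ?nnegrE ?enorm_ge0//.
by rewrite sqr_enorm_reflectionB gerDl mulr_ge0_le0.
Qed.

Lemma polarization_le0 f z : l z <= 0 ->
  polarization e h f z = Num.max (f z) (f (s z)) /\
  polarization e h f (s z) = Num.min (f z) (f (s z)).
Proof.
move=> lz; rewrite /polarization lz level_dist_reflection reflectionK oppr_le0.
(* The remaining case is the mirror itself, where [s z = z] and maximum and minimum agree. *)
split=> //; case: ifPn => [lz'|_]; last by rewrite minC.
have /reflection_fix-> : l z = 0 by apply/eqP; rewrite eq_le lz.
by rewrite maxxx minxx.
Qed.

Lemma polarization_ge0 f z : 0 <= l z ->
  polarization e h f z = Num.min (f z) (f (s z)) /\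
  polarization e h f (s z) = Num.max (f z) (f (s z)).
Proof.
move=> lz; have : l (s z) <= 0 by rewrite level_dist_reflection oppr_le0.
move=> /(polarization_le0 f)[]; rewrite reflectionK => -> ->.
by rewrite minC maxC.
Qed.

Lemma polarizationD f z :
  polarization e h f z + polarization e h f (s z) = f z + f (s z).
Proof.
have [/(polarization_le0 f)[-> ->]|/ltW/(polarization_ge0 f)[-> ->]] := leP (l z) 0.
  by rewrite addr_max_min.
by rewrite addrC addr_max_min.
Qed.

End unit_normal.

(** The affine reflection is the linear one ([h = 0]), which is an additive isometry, followed by
    the translation by [(2 * h) *: e]. *)
Lemma integral_reflection e h (F : V -> \bar R) :
  measurable_fun setT F -> (forall x, (0 <= F x)%E) -> dotp e e = 1 ->
  (\int[lam]_x F (reflection e h x) = \int[lam]_x F x)%E.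
Proof.
move=> mF F0 e1; pose S := reflection e 0.
have SD : {morph S : x y / x + y}.
  move=> x y; rewrite /S /reflection /level_dist !subr0 dotpDl mulrDr scalerDl.
  by rewrite opprD addrACA.
have SK : cancel S S by exact: reflectionK.
have Sn x : enorm (S x) = enorm x.
  rewrite /enorm; congr Num.sqrt; rewrite /S /reflection /level_dist !dotpE e1.
  by rewrite (dotpC e); ring.
have mS : measurable_fun setT S by exact: measurable_reflection.
have iS (G : V -> \bar R) : measurable_fun setT G -> (forall x, (0 <= G x)%E) ->
    (\int[lam]_x G (S x) = \int[lam]_x G x)%E.
  move=> mG G0; rewrite [RHS](eq_measure_integral (pushforward lam S)).
    by rewrite [RHS]ge0_integral_pushforward.
  by move=> /= B mB _; rewrite /pushforward (lebesgue_cV_isometry SD mS mS SK SK Sn).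
rewrite -[RHS](integral_lebesgue_cV_shift ((2 * h) *: e))// -[RHS]iS//.
  apply: eq_integral => x _; congr F.
  by rewrite /S /reflection /level_dist subr0 mulrBr scalerBl opprB addrA addrAC.
exact: (measurableT_comp mF (measurable_colvec_shift _)).
Qed.

Lemma integral_polarization e h (f : V -> R) : dotp e e = 1 ->
  measurable_fun setT f -> (forall x, 0 <= f x) ->
  (\int[lam]_x (polarization e h f x)%:E = \int[lam]_x (f x)%:E)%E.
Proof.
move=> e1 mf f0; have mp := measurable_polarization e h mf.
have p0 x : 0 <= polarization e h f x.
  by rewrite /polarization; case: ifP => _; rewrite ?le_max ?le_min ?f0.
have ms := measurable_reflection e h.
have inv F mF F0 := @integral_reflection e h F mF F0 e1.
apply/eqP; rewrite eq_le; apply/andP; split.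
  by apply: (le_integral_invariant ms inv) => // x; rewrite polarizationD.
by apply: (le_integral_invariant ms inv) => // x; rewrite polarizationD.
Qed.

(** The mirror is the perpendicular bisector of the segment from [y] to [x]; its offset is positive
    because the origin lies on the side of [y]. *)
Lemma exists_reflection x y : enorm y < enorm x ->
  exists e h, [/\ dotp e e = 1, 0 < h & reflection e h y = x].
Proof.
move=> yx; have nxy : 0 < enorm (x - y).
  rewrite lt0r enorm_ge0 andbT; apply: contraTneq yx => /enorm0_eq0/eqP.
  by rewrite subr_eq0 => /eqP ->; rewrite ltxx.
have n0 : enorm (x - y) != 0 by rewrite gt_eqF.
set n := enorm (x - y) in nxy n0.
have dn : dotp (x - y) (x - y) = n ^+ 2 by rewrite enorm_sqr.
exists (n^-1 *: (x - y)), ((enorm x ^+ 2 - enorm y ^+ 2) / (2 * n)); split.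
- by rewrite dotpZl dotpZr dn; field.
- by rewrite divr_gt0 ?mulr_gt0// subr_gt0 ltr_pXn2r ?nnegrE ?enorm_ge0.
- rewrite /reflection scalerA (_ : _ * n^-1 = -1); first by rewrite scaleN1r opprK addrC subrK.
  rewrite /level_dist dotpZr !enorm_sqr.
  have : dotp x x - 2 * dotp x y + dotp y y = n ^+ 2.
    by rewrite -dn !dotpE (dotpC y x); ring.
  rewrite !dotpE (dotpC y x) => dn'.
  have -> : dotp x x = n ^+ 2 + 2 * dotp x y - dotp y y by rewrite -dn'; ring.
  by field.
Qed.

End reflection.

Lemma le_ereal_double (R : realType) (a b : \bar R) :
  (0 <= a -> 0 <= b -> a + a <= b + b -> a <= b)%E.
Proof.
case: a b => [a| |] [b| |] //= _ _; last by move=> _; rewrite leey.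
by rewrite -!EFinD !lee_fin => ab; lra.
Qed.

(* The two kernels have the same total weight, and the larger one is paired
   with the better arrangement. *)
Lemma rearrangement_two_points (R : realType) (a a' b b' K1 K2 : R) : K2 <= K1 ->
  (a * b + a' * b') * K1 + (a' * b + a * b') * K2 <=
  (Num.max a a' * Num.max b b' + Num.min a a' * Num.min b b') * K1 +
  (Num.min a a' * Num.max b b' + Num.max a a' * Num.min b b') * K2.
Proof.
move=> K; have [aa|aa] := leP a a'; have [bb|bb] := leP b b'.
- by lra.
- have := mulr_ge0 (mulr_ge0 (_ : 0 <= K1 - K2) (_ : 0 <= a' - a)) (_ : 0 <= b - b').
  by move=> /(_ ltac:(lra) ltac:(lra) ltac:(lra)); lra.
- have := mulr_ge0 (mulr_ge0 (_ : 0 <= K1 - K2) (_ : 0 <= a - a')) (_ : 0 <= b' - b).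
  by move=> /(_ ltac:(lra) ltac:(lra) ltac:(lra)); lra.
- by lra.
Qed.

Lemma ler_dist_max_min (R : realType) (a a' b b' l : R) :
  `|a - b| <= l -> `|a' - b'| <= l -> `|Num.max a a' - Num.max b b'| <= l /\
  `|Num.min a a' - Num.min b b'| <= l.
Proof.
rewrite !ler_norml => /andP[? ?] /andP[? ?].
by split; have [?|?] := leP a a'; have [?|?] := leP b b'; lra.
Qed.

Lemma ler_dist_max_min_cross (R : realType) (a a' b b' l : R) :
  `|a - b| <= l -> `|a' - b'| <= l -> `|a - b'| <= l -> `|a' - b| <= l ->
  `|Num.max a a' - Num.min b b'| <= l.
Proof.
rewrite !ler_norml => /andP[? ?] /andP[? ?] /andP[? ?] /andP[? ?].
by have [?|?] := leP a a'; have [?|?] := leP b b'; lra.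
Qed.

Section lipschitz.
Context {R : realType} {d : nat}.
Local Notation V := 'cV[R]_d.

(** Measured with [enorm], which reflections preserve, so that polarization keeps the constant [L]
    exactly. *)
Definition elipschitz (L : R) (f : V -> R) :=
  forall x y, `|f x - f y| <= L * enorm (x - y).

Lemma measurable_elipschitz L f : 0 <= L -> elipschitz L f -> measurable_fun setT f.
Proof.
move=> L0 Lf; apply: (measurability _ (RGenOInfty.measurableE R)) => //.
move=> _ [_ [a ->] <-]; rewrite setTI preimage_itvoy; apply: open_measurable_colvec.
apply/open_eballP => x /= ax.
have L1 : 0 < L + 1 by lra.
exists ((f x - a) / (L + 1)); first by rewrite divr_gt0// subr_gt0.
move=> y; rewrite ltr_pdivlMr//= => xy.
have := Lf x y; have := enorm_ge0 (x - y); rewrite ler_norml => ? /andP[_ ?].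
by lra.
Qed.

(** On the same side, maxima are compared with maxima and minima with minima. On opposite sides a
    maximum meets a minimum and all four differences matter; those involving one reflected point are
    controlled because that reflection shortens the distance. *)
Lemma elipschitz_polarization e h L f : dotp e e = 1 -> 0 <= L ->
  elipschitz L f -> elipschitz L (polarization e h f).
Proof.
move=> e1 L0 Lf x y.
set s := reflection e h; set l := level_dist e h.
have Ls u v : `|f (s u) - f (s v)| <= L * enorm (u - v).
  by rewrite (le_trans (Lf _ _))// enorm_reflectionB.
have Lc u v : l u * l v <= 0 -> `|f u - f (s v)| <= L * enorm (u - v).
  move=> luv; rewrite (le_trans (Lf _ _))// ler_wpM2l//.
  exact: ge_enorm_reflectionB.
have Lc' u v : l u * l v <= 0 -> `|f (s u) - f v| <= L * enorm (u - v).
  move=> luv; rewrite (le_trans (Lf _ _))// ler_wpM2l//.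
  by rewrite -enorm_reflectionBr// ge_enorm_reflectionB.
have [lx|lx] := leP (l x) 0; have [ly|ly] := leP (l y) 0.
- have [-> _] := polarization_le0 e1 f lx; have [-> _] := polarization_le0 e1 f ly.
  by have [] := ler_dist_max_min (Lf x y) (Ls x y).
- have [-> _] := polarization_le0 e1 f lx; have [-> _] := polarization_ge0 e1 f (ltW ly).
  have lxy : l x * l y <= 0 by rewrite mulr_le0_ge0 // ltW.
  by apply: ler_dist_max_min_cross; [exact: Lf|exact: Ls|exact: Lc|exact: Lc'].
- have [-> _] := polarization_ge0 e1 f (ltW lx); have [-> _] := polarization_le0 e1 f ly.
  have lxy : l y * l x <= 0 by rewrite mulr_le0_ge0 // ltW.
  rewrite distrC enorm_distC.
  by apply: ler_dist_max_min_cross; [exact: Lf|exact: Ls|exact: Lc|exact: Lc'].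
- have [-> _] := polarization_ge0 e1 f (ltW lx); have [-> _] := polarization_ge0 e1 f (ltW ly).
  by have [] := ler_dist_max_min (Lf x y) (Ls x y).
Qed.

End lipschitz.

(** * Interaction energies under polarization *)

Section energy.
Local Open Scope ereal_scope.
Context {R : realType} {d : nat}.
Local Notation V := 'cV[R]_d.
Local Notation lam := (@lebesgue_cV R d).
Variable k : R -> R.
Hypothesis mk : measurable_fun setT k.
Hypothesis k0 : forall u, (0 <= k u)%R.

Definition pair_energy (f g : V -> R) : \bar R :=
  \int[lam \x lam]_p (f p.1 * g p.2 * k (enorm (p.1 - p.2)))%:E.

Lemma measurable_pair_energy (f g : V -> R) : measurable_fun setT f -> measurable_fun setT g ->
  measurable_fun setT (fun p : V * V => f p.1 * g p.2 * k (enorm (p.1 - p.2)))%R.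
Proof.
move=> mf mg; apply: measurable_funM.
  by apply: measurable_funM; [exact: measurableT_comp|exact: measurableT_comp].
apply: (measurableT_comp mk).
exact: (measurableT_comp measurable_enorm measurable_colvecB).
Qed.

Lemma integral_reflection_fst e h (F : V * V -> \bar R) : dotp e e = 1%R ->
  measurable_fun setT F -> (forall p, 0 <= F p) ->
  \int[lam \x lam]_p F (reflection e h p.1, p.2) = \int[lam \x lam]_p F p.
Proof.
move=> e1 mF F0.
have mr : measurable_fun setT (fun p : V * V => (reflection e h p.1, p.2)).
  apply: measurable_fun_pair => //.
  exact: (measurableT_comp (measurable_reflection e h)).
rewrite [LHS]fubini_tonelli2//; last exact: measurableT_comp.
rewrite [RHS]fubini_tonelli2//; apply: eq_integral => y _.
rewrite /fubini_G /= (@integral_reflection _ _ e h (fun x => F (x, y)))//.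
by apply: measurableT_comp => //; exact: measurable_fun_pair.
Qed.

Lemma integral_reflection_snd e h (F : V * V -> \bar R) : dotp e e = 1%R ->
  measurable_fun setT F -> (forall p, 0 <= F p) ->
  \int[lam \x lam]_p F (p.1, reflection e h p.2) = \int[lam \x lam]_p F p.
Proof.
move=> e1 mF F0.
have mr : measurable_fun setT (fun p : V * V => (p.1, reflection e h p.2)).
  apply: measurable_fun_pair => //.
  exact: (measurableT_comp (measurable_reflection e h)).
rewrite [LHS]fubini_tonelli1//; last exact: measurableT_comp.
rewrite [RHS]fubini_tonelli1//; apply: eq_integral => y _.
rewrite /fubini_F /= (@integral_reflection _ _ e h (fun x => F (y, x)))//.
by apply: measurableT_comp => //; exact: measurable_fun_pair.
Qed.

(** Sum the integrand over the four pairs obtained by reflecting either variable. On them the kernel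
    takes only two values, one for [(x, y)] and [(s x, s y)], the other for the mixed pairs, and the
    two-point rearrangement applies. *)
Lemma pair_energy_polarization e h (f : V -> R) : dotp e e = 1%R ->
  (forall u v, 0 <= u -> u <= v -> k v <= k u)%R ->
  measurable_fun setT f -> (forall x, 0 <= f x)%R ->
  pair_energy f f <= pair_energy (polarization e h f) (polarization e h f).
Proof.
move=> e1 kd mf f0; set f' := polarization e h f.
have mf' : measurable_fun setT f' by exact: measurable_polarization.
have f'0 x : (0 <= f' x)%R.
  by rewrite /f' /polarization; case: ifP => _; rewrite ?le_max ?le_min ?f0.
pose s := reflection e h.
pose t1 (p : V * V) := (s p.1, p.2); pose t2 (p : V * V) := (p.1, s p.2).
have mt1 : measurable_fun setT t1.
  apply: measurable_fun_pair => //.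
  exact: (measurableT_comp (measurable_reflection e h)).
have mt2 : measurable_fun setT t2.
  apply: measurable_fun_pair => //.
  exact: (measurableT_comp (measurable_reflection e h)).
have inv1 F mF F0 := @integral_reflection_fst e h F e1 mF F0.
have inv2 F mF F0 := @integral_reflection_snd e h F e1 mF F0.
rewrite /pair_energy.
pose g (f : V -> R) (p : V * V) := (f p.1 * f p.2 * k (enorm (p.1 - p.2)))%R.
have g0 (f1 : V -> R) p : (forall x, 0 <= f1 x)%R -> (0 <= g f1 p)%R.
  by move=> f10; rewrite !mulr_ge0.
have mg (f1 : V -> R) : measurable_fun setT f1 -> measurable_fun setT (g f1).
  by move=> mf1; exact: measurable_pair_energy.
rewrite -[leLHS]/(\int[lam \x lam]_p (g f p)%:E).
rewrite -[leRHS]/(\int[lam \x lam]_p (g f' p)%:E).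
apply: le_ereal_double; [by apply: integral_ge0 => p _; rewrite lee_fin g0..|].
have gp (f1 : V -> R) : measurable_fun setT f1 -> (forall x, 0 <= f1 x)%R ->
    measurable_fun setT (fun p => g f1 p + g f1 (t1 p))%R /\
    (forall p, 0 <= g f1 p + g f1 (t1 p))%R.
  move=> mf1 f10; split; last by move=> p; rewrite addr_ge0// g0.
  apply: measurable_funD; first exact: mg.
  by apply: measurableT_comp => //; exact: mg.
rewrite -!(integral_add_invariant mt1 inv1); try by [exact: mg|move=> p; exact: g0].
have [mG G0] := gp _ mf f0; have [mG' G'0] := gp _ mf' f'0.
apply: (le_integral_invariant mt2 inv2) => [| |p|p|[x y]]; [exact: mG|exact: mG'|exact: G0|exact: G'0|].
rewrite /t1 /t2 /g /= /f' enorm_reflectionB// -enorm_reflectionBr//.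
set K1 := k (enorm (x - y)); set K2 := k (enorm (x - s y)).
pose l := level_dist e h.
have same : (0 <= l x * l y -> K2 <= K1)%R.
  by move=> lxy; apply: kd; [exact: enorm_ge0|exact: le_enorm_reflectionB].
have opp : (l x * l y <= 0 -> K1 <= K2)%R.
  by move=> lxy; apply: kd; [exact: enorm_ge0|exact: ge_enorm_reflectionB].
have [lx|/ltW lx] := leP (l x) 0%R; have [ly|/ltW ly] := leP (l y) 0%R.
- have [-> ->] := polarization_le0 e1 f lx; have [-> ->] := polarization_le0 e1 f ly.
  have /same K : (0 <= l x * l y)%R by rewrite mulr_le0.
  have := rearrangement_two_points (f x) (f (s x)) (f y) (f (s y)) K.
  by rewrite -/s; lra.
(* On opposite sides [s x] and [y] are the close pair: the inequality is used with [x] and [s x]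
   exchanged, hence with the kernel values exchanged. *)
- have [-> ->] := polarization_le0 e1 f lx; have [-> ->] := polarization_ge0 e1 f ly.
  have /opp K : (l x * l y <= 0)%R by rewrite mulr_le0_ge0.
  have := rearrangement_two_points (f (s x)) (f x) (f y) (f (s y)) K.
  by rewrite -/s (maxC (f (s x))) (minC (f (s x))); lra.
- have [-> ->] := polarization_ge0 e1 f lx; have [-> ->] := polarization_le0 e1 f ly.
  have /opp K : (l x * l y <= 0)%R by rewrite mulr_ge0_le0.
  have := rearrangement_two_points (f (s x)) (f x) (f y) (f (s y)) K.
  by rewrite -/s (maxC (f (s x))) (minC (f (s x))); lra.
- have [-> ->] := polarization_ge0 e1 f lx; have [-> ->] := polarization_ge0 e1 f ly.
  have /same K : (0 <= l x * l y)%R by rewrite mulr_ge0.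
  have := rearrangement_two_points (f x) (f (s x)) (f y) (f (s y)) K.
  by rewrite -/s; lra.
Qed.

End energy.

(** * Almost radial competitors *)

Section competitors.
Context {R : realType} {d : nat}.
Local Notation V := 'cV[R]_d.
Local Notation lam := (@lebesgue_cV R d).
Variable k : R -> R.
Hypothesis mk : measurable_fun setT k.
Hypothesis k0 : forall u, (0 <= k u)%R.
Hypothesis kd : forall u v, 0 <= u -> u <= v -> k v <= k u.

(** [m] caps the volume where [f] is positive and [q] is the energy to be retained. All conditions
    survive polarization with [h > 0], with unchanged parameters. *)
Record competitor (L R0 : R) (m q : \bar R) (f : V -> R) : Prop := Competitor {
  competitor_ge0 : forall x, 0 <= f x ;
  competitor_le1 : forall x, f x <= 1 ;
  competitor_lipschitz : elipschitz L f ;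
  competitor_support : forall x, R0 <= enorm x -> f x = 0 ;
  competitor_volume : (lam [set x | (0 < f x)%R] <= m)%E ;
  competitor_energy : (q <= pair_energy k f f)%E }.

Definition second_moment (f : V -> R) : \bar R :=
  (\int[lam]_x (f x * enorm x ^+ 2)%:E)%E.

Lemma measurable_second_moment (f : V -> R) : measurable_fun setT f ->
  measurable_fun setT (fun x => f x * enorm x ^+ 2).
Proof.
move=> mf; apply: measurable_funM => //.
by apply: measurable_funX; exact: measurable_enorm.
Qed.

Lemma competitor_polarization e h L R0 m q f : dotp e e = 1 -> 0 < h -> 0 <= L ->
  competitor L R0 m q f -> competitor L R0 m q (polarization e h f).
Proof.
move=> e1 h0 L0 [f0 f1 Lf suppf vf qf].
have mf := measurable_elipschitz L0 Lf.
split.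
- by move=> x; rewrite /polarization; case: ifP => _; rewrite ?le_max ?le_min ?f0.
- by move=> x; rewrite /polarization; case: ifP => _; rewrite ?ge_max ?ge_min ?f1.
- exact: elipschitz_polarization.
- move=> x R0x; rewrite /polarization; case: ifPn => lx.
    (* On the side of the origin the reflected point is at least as far out, so both values vanish;
       on the other side the minimum with 0 is 0. *)
    rewrite !suppf ?maxxx// (le_trans R0x)//.
    rewrite -(@ler_pXn2r _ 2) ?nnegrE ?enorm_ge0// sqr_enorm_reflection// lerBrDl.
    by rewrite gerDr mulr_ge0_le0// mulr_ge0// ltW.
  by rewrite (suppf _ R0x); apply/min_idPl.
- have mp (g : V -> R) : measurable_fun setT g -> measurable [set x | 0 < g x].
    by move=> mg; apply: measurable_set_lt.
  have mF := mp _ mf; have mP := mp _ (measurable_polarization e h mf).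
  rewrite (le_trans _ vf)//.
  (* The indicator of the positivity set of the polarized function is the polarization of the
     indicator of the positivity set of [f]. *)
  rewrite -[X in lam X]setIT -integral_indic// -[X in (_ <= lam X)%E]setIT.
  rewrite -[leRHS]integral_indic// -[leRHS](integral_polarization h e1); last 2 first.
  - exact: measurable_indic.
  - by [].
  rewrite le_eqVlt; apply/orP; left; apply/eqP; apply: eq_integral => x _.
  have gt0 (u : V -> R) z : \1_[set x | 0 < u x] z = (0 < u z)%R%:R :> R.
    by rewrite indicE; congr (_%:R); congr nat_of_bool; apply/idP/idP; rewrite inE.
  congr (_%:E); rewrite gt0 /polarization !gt0; case: ifP => _.
    rewrite lt_max; case: (0 < f x); case: (0 < f _) => //=;
    by rewrite ?maxxx ?(max_idPl ler01) ?(max_idPr ler01).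
  rewrite lt_min; case: (0 < f x); case: (0 < f _) => //=;
  by rewrite ?minxx ?(min_idPl ler01) ?(min_idPr ler01).
- by rewrite (le_trans qf)//; exact: pair_energy_polarization.
Qed.

Lemma measurable_eball_center (y : V) (r : R) : measurable [set z | enorm (z - y) < r].
Proof.
apply: measurable_set_lt => //.
exact: (measurableT_comp measurable_enorm (measurable_colvec_shift (- y))).
Qed.

Lemma lebesgue_cV_preimage_shift (y : V) (B : set V) : measurable B ->
  lam ((fun z => z + y) @^-1` B) = lam B.
Proof.
move=> mB; have ind C : measurable C -> lam C = (\int[lam]_x (\1_C x)%:E)%E.
  by move=> mC; rewrite integral_indic// setIT.
have mBy : measurable ((fun z : V => z + y) @^-1` B).
  by rewrite -[X in measurable X]setTI; exact: (measurable_colvec_shift y).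
rewrite [LHS]ind// [RHS]ind//.
rewrite -(integral_lebesgue_cV_shift y (F := fun x => (\1_B x)%:E)).
- by apply: eq_integral => x _; congr (_%:E); rewrite !indicE; congr (_%:R); congr nat_of_bool; apply/idP/idP; rewrite !inE.
- by apply/measurable_EFinP; exact: measurable_indic.
- by move=> x; rewrite lee_fin.
Qed.

(** Reflect [y] to [x]. Within eps/(4(L+1)) of [y], the gaps in norm and in value between [z] and
    [s z] are still at least eps/2. There polarization swaps the two values and lowers the summed
    moment by the gap in value times the gap in squared norm, hence by at least (eps/2)(eps/2)^2. *)
Lemma second_moment_polarization (f : V -> R) (L eps : R) (x y : V) :
  0 <= L -> 0 < eps -> (forall z, 0 <= f z) -> elipschitz L f ->
  enorm y + eps <= enorm x -> f y + eps < f x ->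
  exists e h, [/\ dotp e e = 1, 0 < h &
    (second_moment (polarization e h f) +
       ((eps / 2) ^+ 3)%:E * lam (eball (eps / (4 * (L + 1)))) <= second_moment f)%E].
Proof.
move=> L0 eps0 f0 Lf yx fyx.
have [|e [h [e1 h0 sy]]] := @exists_reflection _ _ x y; first by lra.
exists e, h; split => //.
pose s := reflection e h; pose l := level_dist e h.
set P := polarization e h f.
have mf := measurable_elipschitz L0 Lf.
have mP : measurable_fun setT P by exact: measurable_polarization.
have P0 z : 0 <= P z.
  by rewrite /P /polarization; case: ifP => _; rewrite ?le_max ?le_min ?f0.
set c := (eps / 2) ^+ 3; set del := eps / (4 * (L + 1)).
have c0 : 0 <= c by rewrite exprn_ge0// divr_ge0 ?ltW.
pose B : set V := [set z | enorm (z - y) < del].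
have mB : measurable B by exact: measurable_eball_center.
have del0 : 0 < del by rewrite divr_gt0// mulr_gt0//; lra.
have delE : del * (4 * (L + 1)) = eps by rewrite /del mulfVK// gt_eqF// mulr_gt0//; lra.
have Ldel0 : 0 <= L * del by rewrite mulr_ge0// ltW.
have near z : B z -> enorm z + eps / 2 <= enorm (s z) /\ f z + eps / 2 <= f (s z).
  rewrite /B/= => zy.
  have sz : enorm (s z - x) = enorm (z - y).
    by rewrite -sy enorm_reflectionB.
  have Lz : L * enorm (z - y) <= L * del by rewrite ler_wpM2l// ltW.
  split.
    have := ler_enormD (z - y) y; rewrite subrK => h1.
    have := ler_enormD (x - s z) (s z); rewrite subrK enorm_distC sz => h2.
    by lra.
  have := Lf z y; have := Lf (s z) x; rewrite sz !ler_norml => /andP[? ?] /andP[? ?].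
  by lra.
have lz z : (l z <= 0) = (enorm z <= enorm (s z)).
  rewrite -(@ler_pXn2r _ 2 _ (enorm z)) ?nnegrE ?enorm_ge0// sqr_enorm_reflection// -/l.
  rewrite lerBrDl gerDr pmulr_rle0//; by rewrite mulr_gt0.
have general z : P z * enorm z ^+ 2 + P (s z) * enorm (s z) ^+ 2 <=
    f z * enorm z ^+ 2 + f (s z) * enorm (s z) ^+ 2.
  have [lz0|lz0] := leP (l z) 0.
    rewrite /P; have [-> ->] := polarization_le0 e1 f lz0; move: lz0; rewrite lz -/s.
    rewrite -(@ler_pXn2r _ 2 _ (enorm z)) ?nnegrE ?enorm_ge0// => zz.
    have [ff|ff] := leP (f z) (f (s z)); last by lra.
    have := mulr_ge0 (_ : 0 <= f (s z) - f z) (_ : 0 <= enorm (s z) ^+ 2 - enorm z ^+ 2).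
    by move=> /(_ ltac:(lra) ltac:(lra)); lra.
  rewrite /P; have [-> ->] := polarization_ge0 e1 f (ltW lz0); move: lz0; rewrite ltNge lz -/s -ltNge.
  move/ltW; rewrite -(@ler_pXn2r _ 2 _ (enorm (s z))) ?nnegrE ?enorm_ge0// => zz.
  have [ff|ff] := leP (f z) (f (s z)); first by lra.
  have := mulr_ge0 (_ : 0 <= f z - f (s z)) (_ : 0 <= enorm z ^+ 2 - enorm (s z) ^+ 2).
  by move=> /(_ ltac:(lra) ltac:(lra)); lra.
have gain z : B z -> P z * enorm z ^+ 2 + P (s z) * enorm (s z) ^+ 2 + c <=
    f z * enorm z ^+ 2 + f (s z) * enorm (s z) ^+ 2.
  move=> /near[zs fzs].
  have lz0 : l z <= 0 by rewrite lz; lra.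
  rewrite /P; have [-> ->] := polarization_le0 e1 f lz0; rewrite -/s.
  have [_|ff] := leP (f z) (f (s z)); last by lra.
  have zs2 : (eps / 2) ^+ 2 <= enorm (s z) ^+ 2 - enorm z ^+ 2.
    rewrite lerBrDl (@le_trans _ _ ((enorm z + eps / 2) ^+ 2))//; last first.
      by rewrite ler_pXn2r// ?nnegrE ?enorm_ge0// addr_ge0 ?enorm_ge0// divr_ge0// ltW.
    rewrite sqrrD lerD2r lerDl mulrn_wge0// mulr_ge0 ?enorm_ge0// divr_ge0//; exact: ltW.
  have : c <= (f (s z) - f z) * (enorm (s z) ^+ 2 - enorm z ^+ 2).
    by rewrite /c exprS; apply: ler_pM; rewrite ?sqr_ge0//; lra.
  by lra.
have mfr : measurable_fun setT (fun z => P z * enorm z ^+ 2 + c * \1_B z).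
  apply: measurable_funD; first exact: measurable_second_moment.
  by apply: measurable_funM => //; exact: measurable_indic.
rewrite -(lebesgue_cV_preimage_shift (- y) (measurable_eball _)) -/del -[_ @^-1` _]/B.
have -> : (second_moment P + c%:E * lam B =
    \int[lam]_z (P z * enorm z ^+ 2 + c * \1_B z)%:E)%E.
  under eq_integral do rewrite EFinD.
  rewrite ge0_integralD//=; last 4 first.
  - by move=> z _; rewrite lee_fin mulr_ge0// sqr_ge0.
  - by apply/measurable_EFinP; exact: measurable_second_moment.
  - by move=> z _; rewrite lee_fin mulr_ge0.
  - apply/measurable_EFinP; apply: measurable_funM => //; exact: measurable_indic.
  congr (_ + _)%E; under eq_integral do rewrite EFinM.
  rewrite ge0_integralZl_EFin//; first by rewrite integral_indic// setIT.
  by apply/measurable_EFinP; exact: measurable_indic.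
have ms := measurable_reflection e h.
have inv F mF F0 := @integral_reflection _ _ e h F mF F0 e1.
apply: (le_integral_invariant ms inv) => [||z|z|z].
- exact: mfr.
- exact: measurable_second_moment.
- by apply: addr_ge0; apply: mulr_ge0; rewrite ?sqr_ge0 ?P0 ?indicE.
- by apply: mulr_ge0; rewrite ?sqr_ge0 ?f0.
- rewrite -/s.
  (* [z] and [s z] cannot both lie in [B], as each would be nearer to the origin than the other; so
     each pair owes the gain at most once. *)
  have [zB|zB] := pselect (B z); have [szB|szB] := pselect (B (s z)).
  + by have [] := near _ zB; have [] := near _ szB; rewrite /s reflectionK// -/s; lra.
  + rewrite !indicE (mem_set zB) (memNset szB) mulr1 mulr0; have := gain _ zB; lra.
  + rewrite !indicE (mem_set szB) (memNset zB) mulr1 mulr0; have := gain _ szB.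
    by rewrite /s reflectionK// -/s; lra.
  + rewrite !indicE (memNset szB) (memNset zB) !mulr0; have := general z; lra.
Qed.

(* Take f with second moment below the infimum plus the gain of
   [second_moment_polarization]. *)
Lemma exists_almost_radial (L R0 eps : R) m q (f0 : V -> R) :
  0 <= L -> 0 < eps -> competitor L R0 m q f0 ->
  exists2 f, competitor L R0 m q f &
    forall x y, enorm y + eps <= enorm x -> f x <= f y + eps.
Proof.
move=> L0 eps0 cf0.
pose S : set \bar R := [set second_moment f | f in competitor L R0 m q].
have S0 f : competitor L R0 m q f -> (0 <= second_moment f)%E.
  by move=> cf; apply: integral_ge0 => x _; rewrite lee_fin mulr_ge0 ?sqr_ge0 ?(competitor_ge0 cf).
(* The values and the support of [f0] are bounded, so its second moment is finite; the infimum is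
   then a real number that can be approached within [eta]. *)
have J0fin : (second_moment f0 < +oo)%E.
  have mf := measurable_elipschitz L0 (competitor_lipschitz cf0).
  apply: (@le_lt_trans _ _ (\int[lam]_x ((R0 ^+ 2)%:E * (\1_(eball R0) x)%:E))%E).
    apply: ge0_le_integral => //.
    - by move=> x _; rewrite lee_fin mulr_ge0 ?sqr_ge0 ?(competitor_ge0 cf0).
    - by apply/measurable_EFinP; exact: measurable_second_moment.
    - apply/measurable_EFinP; apply: measurable_funM => //; apply: measurable_indic.
      exact: measurable_eball.
    - move=> x _; rewrite -EFinM lee_fin; have [xR|xR] := ltP (enorm x) R0.
        rewrite indicE mem_set// mulr1 -[leRHS]mul1r ler_pM ?sqr_ge0//.
        + exact: (competitor_ge0 cf0).
        + exact: (competitor_le1 cf0).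
        + by rewrite ler_pXn2r ?nnegrE ?enorm_ge0 ?(le_trans (enorm_ge0 x))// ltW.
      by rewrite (competitor_support cf0)// mul0r mulr_ge0 ?sqr_ge0.
  rewrite ge0_integralZl_EFin//; last 2 first.
  - by apply/measurable_EFinP; apply: measurable_indic; exact: measurable_eball.
  - exact: sqr_ge0.
  rewrite integral_indic//; last exact: measurable_eball.
  by rewrite setIT lte_mul_pinfty// ?lee_fin ?sqr_ge0// lebesgue_cV_eball_ltey.
have infS : ereal_inf S \is a fin_num.
  rewrite ge0_fin_numE.
    by apply: le_lt_trans J0fin; apply: ereal_inf_lbound; exists f0.
  by apply: le_ereal_inf_tmp => _ [f cf <-]; exact: S0.
pose eta := fine (((eps / 2) ^+ 3)%:E * lam (eball (eps / (4 * (L + 1)))))%E.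
have del0 : 0 < eps / (4 * (L + 1)) by rewrite divr_gt0// mulr_gt0//; lra.
have etaE : (((eps / 2) ^+ 3)%:E * lam (eball (eps / (4 * (L + 1)))))%E = eta%:E.
  rewrite /eta fineK// fin_numM// ge0_fin_numE//.
  exact: lebesgue_cV_eball_ltey.
have eta0 : 0 < eta.
  by rewrite -lte_fin -etaE mule_gt0 ?lebesgue_cV_eball_gt0// lte_fin exprn_gt0// divr_gt0.
have [_ [f cf <-] fS] := lb_ereal_inf_adherent eta0 infS.
exists f => // x y yx; rewrite leNgt; apply/negP => fyx.
have [e [h [e1 h0]]] := second_moment_polarization L0 eps0 (competitor_ge0 cf)
  (competitor_lipschitz cf) yx fyx.
rewrite etaE => /le_lt_trans/(_ fS); apply/negP; rewrite -leNgt leeD2r//.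
apply: ereal_inf_lbound; exists (polarization e h f) => //.
exact: competitor_polarization.
Qed.

End competitors.

(** Up to the unit ball volume, the bracket is the mass by which an almost radial competitor may
    exceed the indicator of the ball: an annulus of width 2 eps plus eps on the ball of radius
    R0. *)
Lemma exists_small_pow (R : realType) (C C' r e : R) n : 0 < e ->
  exists2 eps, 0 < eps & C * ((r + 2 * eps) ^+ n - r ^+ n + eps * C') <= e.
Proof.
move=> e0; pose u (j : nat) : R := j.+1%:R^-1.
have cu : u @ \oo --> (0 : R) by exact: cvg_harmonic.
have cru : (fun j => r + 2 * u j) @ \oo --> r.
  rewrite [X in _ --> X](_ : _ = r + 2 * 0); last by ring.
  by apply: cvgD; [exact: cvg_cst|apply: cvgM => //; exact: cvg_cst].
have cp : (fun j => (r + 2 * u j) ^+ n) @ \oo --> r ^+ n.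
  exact: (cvg_comp _ _ cru (@exprn_continuous _ n r)).
have c0 : (fun j => C * ((r + 2 * u j) ^+ n - r ^+ n + u j * C')) @ \oo --> (0 : R).
  rewrite [X in _ --> X](_ : _ = C * (r ^+ n - r ^+ n + 0 * C')); last by ring.
  apply: cvgM; first exact: cvg_cst.
  apply: cvgD; first by apply: cvgB => //; exact: cvg_cst.
  by apply: cvgM => //; exact: cvg_cst.
have /cvgrPdist_le/(_ e e0)[N _ /(_ N (leqnn N))] := c0.
rewrite /= sub0r normrN => h; exists (u N); first by rewrite invr_gt0.
exact: le_trans (ler_norm _) h.
Qed.

(** * Comparison with a ball for bounded kernels *)

Section lipschitz_rearrangement.
Local Open Scope ereal_scope.
Context {R : realType} {d : nat} (d_gt0 : (0 < d)%N).
Local Notation V := 'cV[R]_d.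
Local Notation lam := (@lebesgue_cV R d).
Local Notation w := (@unit_ball_volume R d).

Lemma integral_mul_fst_snd (u v : V -> R) :
  measurable_fun setT u -> measurable_fun setT v ->
  (forall x, 0 <= u x)%R -> (forall x, 0 <= v x)%R ->
  \int[lam \x lam]_p (u p.1 * v p.2)%:E =
  \int[lam]_x (u x)%:E * \int[lam]_x (v x)%:E.
Proof.
move=> mu mv u0 v0; rewrite fubini_tonelli1.
- transitivity (\int[lam]_x ((u x)%:E * \int[lam]_x (v x)%:E)).
    apply: eq_integral => x _; rewrite /fubini_F /=.
    under eq_integral do rewrite EFinM.
    rewrite ge0_integralZl_EFin//; first by move=> y _; rewrite lee_fin.
    exact/measurable_EFinP.
  rewrite ge0_integralZr//.
  - exact/measurable_EFinP.
  - by move=> x _; rewrite lee_fin.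
  - by apply: integral_ge0 => x _; rewrite lee_fin.
- apply/measurable_EFinP; apply: measurable_funM.
    exact: (measurableT_comp mu).
  exact: (measurableT_comp mv).
- by move=> p; rewrite lee_fin mulr_ge0.
Qed.

Variables (k : R -> R) (M : R).
Hypothesis mk : measurable_fun setT k.
Hypothesis k0 : forall u, (0 <= k u)%R.
Hypothesis kM : forall u, (k u <= M)%R.
Hypothesis kd : forall u v, (0 <= u -> u <= v -> k v <= k u)%R.

(** If [f x > eps] that far out, almost monotonicity makes [f] positive on the ball of radius
    [enorm x - eps], which exceeds [r]; this contradicts the volume bound. *)
Lemma almost_radial_le (L R0 r eps : R) q (f : V -> R) :
  (0 <= r)%R -> (0 < eps)%R -> competitor k L R0 (lam (eball r)) q f ->
  (0 <= L)%R ->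
  (forall x y, enorm y + eps <= enorm x -> f x <= f y + eps)%R ->
  forall x, (r + 2 * eps <= enorm x -> f x <= eps)%R.
Proof.
move=> r0 eps0 cf L0 rf x rx; rewrite leNgt; apply/negP => fx.
have mf := measurable_elipschitz L0 (competitor_lipschitz cf).
have : lam (eball (enorm x - eps)) <= lam (eball r).
  apply: le_trans (competitor_volume cf); apply: le_measure; rewrite ?inE.
  - exact: measurable_eball.
  - exact: measurable_set_lt.
  - move=> y; rewrite /eball/= ltrBrDr => /ltW/rf; lra.
rewrite !lebesgue_cV_eball//; last lra.
rewrite lee_fin ler_pM2r ?unit_ball_volume_gt0// ler_pXn2r// ?nnegrE//; lra.
Qed.

(** An almost radial competitor satisfies f <= b + g, with b the indicator of the ball and g of
    small mass. As f and b lie below the indicator B of the ball of radius R0, the product f(x) f(y)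
    exceeds b(x) b(y) by at most B(x) g(y) + g(x) B(y), and the bound M on the kernel turns this
    into a small error. *)
Lemma pair_energy_le_ball (L R0 r : R) (f0 : V -> R) :
  (0 <= L)%R -> (0 <= r)%R -> (r <= R0)%R ->
  (forall x, 0 <= f0 x <= 1)%R -> elipschitz L f0 ->
  (forall x, R0 <= enorm x -> f0 x = 0)%R ->
  lam [set x | (0 < f0 x)%R] <= lam (eball r) ->
  pair_energy k f0 f0 <= pair_energy k \1_(@eball R d r) \1_(eball r).
Proof.
move=> L0 r0 rR0 f01 Lf0 supp0 vol0.
have M0 : (0 <= M)%R by apply: le_trans (k0 0) (kM 0).
have R00 : (0 <= R0)%R by exact: le_trans rR0.
have cf0 : competitor k L R0 (lam (eball r)) (pair_energy k f0 f0) f0.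
  by split=> // x; have /andP[] := f01 x.
apply/lee_addgt0Pr => e e0.
(* The constants are those of the final error, 2 M times the volume of the ball of radius R0 times
   the integral of [g]. *)
have [eps eps0 Heps] := @exists_small_pow R (M * (2 * (R0 ^+ d * w)) * w)%R (R0 ^+ d) r e d e0.
have [f cf rf] := exists_almost_radial mk k0 kd L0 eps0 cf0.
have mf := measurable_elipschitz L0 (competitor_lipschitz cf).
have f_ge0 := competitor_ge0 cf.
have f_small := almost_radial_le r0 eps0 cf L0 rf.
pose G : set V := eball (r + 2 * eps) `\` eball r.
have mball s : measurable (@eball R d s) by exact: measurable_eball.
have mG : measurable G by exact: measurableD.
pose b : V -> R := \1_(eball r); pose B : V -> R := \1_(eball R0).
pose g x : R := (\1_G x + eps * B x)%R.
have b0 x : (0 <= b x)%R by rewrite /b indicE.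
have B0 x : (0 <= B x)%R by rewrite /B indicE.
have g0 x : (0 <= g x)%R by rewrite addr_ge0 ?mulr_ge0 ?indicE// ltW.
have mb : measurable_fun setT b by exact: measurable_indic.
have mB : measurable_fun setT B by exact: measurable_indic.
have mg : measurable_fun setT g.
  apply: measurable_funD; first exact: measurable_indic.
  exact: measurable_funM.
have bB x : (b x <= B x)%R.
  rewrite /b /B !indicE ler_nat; case: (boolP (x \in eball r)) => //.
  by rewrite inE => xr; rewrite mem_set//; exact: lt_le_trans xr rR0.
have fB x : (f x <= B x)%R.
  rewrite /B indicE; have [xR|xR] := ltP (enorm x) R0.
    by rewrite mem_set//; exact: (competitor_le1 cf).
  by rewrite (competitor_support cf).
have fbg x : (f x <= b x + g x)%R.
  have f1 := competitor_le1 cf x.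
  have [xr|xr] := ltP (enorm x) r.
    by rewrite /b indicE mem_set//= (le_trans f1)// lerDl.
  have [xe|xe] := ltP (enorm x) (r + 2 * eps)%R.
    have G1 : (\1_G x = 1 :> R)%R.
      by rewrite indicE mem_set//; split=> //; rewrite /eball/=; apply/negP; rewrite -leNgt.
    by rewrite /g G1 (le_trans f1)// addrCA lerDl addr_ge0// mulr_ge0// ltW.
  have [xR|xR] := ltP (enorm x) R0.
    have B1 : (B x = 1)%R by rewrite /B indicE mem_set.
    have := f_small _ xe; have := b0 x; rewrite /g B1 mulr1.
    have : (0 <= \1_G x :> R)%R by rewrite indicE.
    lra.
  by rewrite (competitor_support cf)// addr_ge0.
have lG : lam G = (((r + 2 * eps) ^+ d - r ^+ d) * w)%:E.
  have re0 : (0 <= r + 2 * eps)%R by lra.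
  have sub : @eball R d r `<=` eball (r + 2 * eps).
    by move=> x; rewrite /eball/= => xr; rewrite (lt_le_trans xr)//; lra.
  rewrite measureD//=.
    by rewrite setIidr// !lebesgue_cV_eball// -EFinB mulrBl.
  by rewrite lebesgue_cV_eball// ltry.
have ind (S : set V) : measurable S -> \int[lam]_x (\1_S x)%:E = lam S.
  by move=> mS; rewrite integral_indic// setIT.
have ig : \int[lam]_x (g x)%:E =
    (((r + 2 * eps) ^+ d - r ^+ d + eps * R0 ^+ d) * w)%:E.
  under eq_integral do rewrite EFinD EFinM.
  have mEi (S : set V) : measurable S -> measurable_fun setT (fun x : V => (\1_S x)%:E : \bar R).
    by move=> mS; apply/measurable_EFinP; exact: measurable_indic.
  rewrite ge0_integralD//=; last 3 first.
  - exact: mEi.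
  - by move=> x _; rewrite -EFinM lee_fin mulr_ge0// ltW.
  - apply: measurable_funeM; exact: mEi.
  rewrite ge0_integralZl_EFin//; last 3 first.
  - by move=> x _; rewrite lee_fin.
  - exact: mEi.
  - exact: ltW.
  have indB : \int[lam]_x (B x)%:E = lam (eball R0) by exact: ind.
  by rewrite ind// indB lG lebesgue_cV_eball// -EFinM -EFinD; congr (_%:E); ring.
apply: le_trans (competitor_energy cf) _.
pose kk (p : V * V) := k (enorm (p.1 - p.2)).
have mkk : measurable_fun setT kk.
  apply: (measurableT_comp mk).
  exact: (measurableT_comp measurable_enorm measurable_colvecB).
have mfs (u v : V -> R) : measurable_fun setT u -> measurable_fun setT v ->
    measurable_fun setT (fun p : V * V => u p.1 * v p.2)%R.
  by move=> mu mv; apply: measurable_funM; exact: measurableT_comp.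
have bound (p : V * V) : (f p.1 * f p.2 * kk p <=
    b p.1 * b p.2 * kk p + M * (B p.1 * g p.2 + g p.1 * B p.2))%R.
  have h1 : (f p.1 * f p.2 <= b p.1 * b p.2 + (B p.1 * g p.2 + g p.1 * B p.2))%R.
    apply: (@le_trans _ _ ((b p.1 + g p.1) * f p.2)%R); first exact: ler_wpM2r.
    apply: (@le_trans _ _ (b p.1 * (b p.2 + g p.2) + g p.1 * B p.2)%R).
      by rewrite mulrDl lerD// ler_wpM2l.
    by rewrite mulrDr -addrA !lerD// ler_wpM2r.
  apply: (le_trans (ler_wpM2r (k0 _) h1)); rewrite mulrDl lerD2l mulrC.
  by rewrite ler_wpM2r ?kM// addr_ge0// mulr_ge0.
apply: (@le_trans _ _ (\int[lam \x lam]_p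
    (b p.1 * b p.2 * kk p + M * (B p.1 * g p.2 + g p.1 * B p.2))%:E)).
  apply: ge0_le_integral => //.
  - by move=> p _; rewrite lee_fin !mulr_ge0.
  - apply/measurable_EFinP; exact: measurable_pair_energy.
  - apply/measurable_EFinP; apply: measurable_funD.
      exact: measurable_pair_energy.
    apply: measurable_funM => //; apply: measurable_funD; exact: mfs.
  - by move=> p _; rewrite lee_fin; exact: bound.
under eq_integral do rewrite EFinD (EFinM M) EFinD.
rewrite ge0_integralD//=; last 4 first.
- by move=> p _; rewrite lee_fin; apply: mulr_ge0; [exact: mulr_ge0|exact: k0].
- apply/measurable_EFinP; exact: measurable_pair_energy.
- by move=> p _; rewrite -EFinD -EFinM lee_fin mulr_ge0// addr_ge0// mulr_ge0.
- apply: measurable_funeM; apply: emeasurable_funD; apply/measurable_EFinP; exact: mfs.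
apply: leeD; first by [].
rewrite ge0_integralZl_EFin//; last 2 first.
- by move=> p _; rewrite -EFinD lee_fin addr_ge0// mulr_ge0.
- by apply: emeasurable_funD; apply/measurable_EFinP; exact: mfs.
rewrite ge0_integralD//; last 4 first.
- by move=> p _; rewrite lee_fin mulr_ge0.
- by apply/measurable_EFinP; exact: mfs.
- by move=> p _; rewrite lee_fin mulr_ge0.
- by apply/measurable_EFinP; exact: mfs.
have indB : \int[lam]_x (B x)%:E = lam (eball R0) by exact: ind.
rewrite !integral_mul_fst_snd// ig indB lebesgue_cV_eball// -!EFinM lee_fin.
apply: le_trans Heps; rewrite le_eqVlt; apply/orP; left; apply/eqP; ring.
Qed.

End lipschitz_rearrangement.

(** Monotone convergence where the limit only has to dominate [f]: at each point some [g n] already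
    does. *)
Lemma integral_le_monotone dT (T : measurableType dT) (R : realType)
    (mu : {measure set T -> \bar R}) (f : T -> R) (g : nat -> T -> R) (C : \bar R) :
  measurable_fun setT f -> (forall n, measurable_fun setT (g n)) ->
  (forall x, 0 <= f x) -> (forall n x, 0 <= g n x) ->
  (forall n m x, (n <= m)%N -> g n x <= g m x) ->
  (forall x, exists n, f x <= g n x) ->
  (forall n, \int[mu]_x (g n x)%:E <= C)%E ->
  (\int[mu]_x (f x)%:E <= C)%E.
Proof.
move=> mf mg f0 g0 ndg fg gC.
have mgE n : measurable_fun setT (EFin \o g n) by apply/measurable_EFinP.
have nd x : [set: T] x -> nondecreasing_seq (fun n => (EFin \o g n) x).
  by move=> _ n m nm; rewrite lee_fin ndg.
have cvx x : cvgn (fun n => (EFin \o g n) x).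
  exact: ereal_nondecreasing_is_cvgn (nd x I).
apply: (@le_trans _ _ (\int[mu]_x limn (fun n => (EFin \o g n) x))%E).
  apply: ge0_le_integral => //.
  - by move=> x _; rewrite lee_fin.
  - exact/measurable_EFinP.
  - apply: (emeasurable_fun_cvg (fun n => EFin \o g n)) => // x _; exact: cvx.
  - move=> x _; have [n fn] := fg x.
    apply: lime_ge; first exact: cvx.
    exists n => // m /= nm; rewrite lee_fin (le_trans fn)//; exact: ndg.
rewrite monotone_convergence//; last by move=> n x _; rewrite lee_fin.
apply: lime_le; last by apply: nearW => n; exact: gC.
apply: ereal_nondecreasing_is_cvgn => n m nm.
apply: ge0_le_integral => //; first by move=> x _; rewrite lee_fin.
by move=> x _; exact: nd.
Qed.

(** * The Riesz kernel *)

Section riesz_kernel.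
Context {R : realType}.
Variable t : R.
Hypothesis t0 : 0 < t.

(** Freezing the argument below 1/(n+1) makes the kernel bounded and nonincreasing on the whole
    half-line, including 0, where the power itself is 0 by convention. *)
Definition truncated_power n (u : R) : R := (Num.max u n.+1%:R^-1) `^ (- t).

Lemma powRN_le u v : 0 < u -> u <= v -> v `^ (- t) <= u `^ (- t).
Proof.
move=> u0 uv; have v0 : 0 < v by exact: lt_le_trans uv.
rewrite !powRN lef_pV2 ?posrE ?powR_gt0// ge0_ler_powR ?nnegrE//; exact: ltW.
Qed.

Lemma powR0N : (0 : R) `^ (- t) = 0.
Proof. by rewrite powR0// oppr_eq0 gt_eqF. Qed.

Lemma measurable_truncated_power n : measurable_fun setT (truncated_power n).
Proof.
apply: (measurableT_comp (@measurable_powR R (- t))).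
exact: measurable_maxr.
Qed.

Lemma truncated_power_ge0 n u : 0 <= truncated_power n u.
Proof. exact: powR_ge0. Qed.

Lemma truncated_power_le n u : truncated_power n u <= n.+1%:R^-1 `^ (- t).
Proof. by apply: powRN_le; rewrite ?invr_gt0// le_max lexx orbT. Qed.

Lemma truncated_power_nincr n u v : 0 <= u -> u <= v ->
  truncated_power n v <= truncated_power n u.
Proof.
move=> u0 uv; apply: powRN_le; first by rewrite lt_max invr_gt0 ltr0n orbT.
by rewrite ge_max !le_max uv lexx orbT.
Qed.

Lemma truncated_power_le_powR n u : 0 < u -> truncated_power n u <= u `^ (- t).
Proof. by move=> u0; apply: powRN_le => //; rewrite le_max lexx. Qed.

Lemma powR_le_truncated_power n u : n.+1%:R^-1 <= u ->
  u `^ (- t) = truncated_power n u.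
Proof. by move=> nu; rewrite /truncated_power max_l. Qed.

End riesz_kernel.

(** * Lipschitz cutoffs of an open set *)

Section cutoff.
Context {R : realType} {d : nat}.
Local Notation V := 'cV[R]_d.
Variable D : set V.
Hypothesis DC0 : ~` D !=set0.

(** This is min(1, (n+1) dist(x, ~D)); for open [D] it equals the indicator of [D] at each point
    from some stage on. *)
Definition cutoff n (x : V) : R :=
  inf [set Num.min 1 (n.+1%:R * enorm (x - y)) | y in ~` D].

Lemma cutoff_set_ge0 n x :
  lbound [set Num.min 1 (n.+1%:R * enorm (x - y)) | y in ~` D] 0.
Proof. by move=> _ [y _ <-]; rewrite le_min ler01 mulr_ge0 ?enorm_ge0. Qed.

Lemma cutoff_le n x y : ~ D y -> cutoff n x <= Num.min 1 (n.+1%:R * enorm (x - y)).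
Proof.
move=> Dy; apply: ge_inf; first by exists 0; exact: cutoff_set_ge0.
by exists y.
Qed.

Lemma le_cutoff n x c :
  (forall y, ~ D y -> c <= Num.min 1 (n.+1%:R * enorm (x - y))) -> c <= cutoff n x.
Proof.
move=> H; apply: lb_le_inf; first by have [y Dy] := DC0; eexists; exists y.
by move=> _ [y Dy <-]; exact: H.
Qed.

Lemma cutoff_ge0 n x : 0 <= cutoff n x.
Proof. by apply: le_cutoff => y Dy; apply: (@cutoff_set_ge0 n x); exists y. Qed.

Lemma cutoff_le1 n x : cutoff n x <= 1.
Proof.
by have [y Dy] := DC0; rewrite (le_trans (cutoff_le n x Dy))// ge_min lexx.
Qed.

Lemma cutoff_out n x : ~ D x -> cutoff n x = 0.
Proof.
move=> Dx; apply/eqP; rewrite eq_le cutoff_ge0 andbT.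
by rewrite (le_trans (cutoff_le n x Dx))// subrr enorm0 mulr0 ge_min lexx orbT.
Qed.

Lemma cutoff_lipschitz n : elipschitz n.+1%:R (cutoff n).
Proof.
have half x y : cutoff n x - cutoff n y <= n.+1%:R * enorm (x - y).
  rewrite lerBlDl -lerBlDr; apply: le_cutoff => z Dz.
  rewrite lerBlDr (le_trans (cutoff_le n x Dz))//.
  have := ler_enorm_add x y z; rewrite -(@ler_pM2l _ n.+1%:R)// mulrDr => h.
  have : 0 <= n.+1%:R * enorm (x - y) by rewrite mulr_ge0 ?enorm_ge0.
  by move=> ?; have [?|?] := leP 1 (n.+1%:R * enorm (x - z)); have [?|?] := leP 1 (n.+1%:R * enorm (y - z)); lra.
move=> x y; rewrite ler_norml half andbT lerNl opprB enorm_distC; exact: half.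
Qed.

Lemma cutoff_nondecreasing n m x : (n <= m)%N -> cutoff n x <= cutoff m x.
Proof.
move=> nm; apply: le_cutoff => y Dy; rewrite (le_trans (cutoff_le n x Dy))//.
rewrite le_min !ge_min lexx/=; apply/orP; right.
by rewrite ler_wpM2r ?enorm_ge0// ler_nat.
Qed.

Lemma cutoff_eventually1 x : open D -> D x ->
  exists n, forall m, (n <= m)%N -> cutoff m x = 1.
Proof.
move=> /open_eballP oD /oD[e e0 De]; exists (Num.truncn e^-1) => m nm.
apply/eqP; rewrite eq_le cutoff_le1/=; apply: le_cutoff => y Dy.
rewrite le_min lexx/=.
have exy : e <= enorm (x - y) by rewrite leNgt; apply/negP => /De.
apply: le_trans (ler_wpM2l _ exy) => //.
rewrite -ler_pdivrMr// mul1r (le_trans (ltW (truncnS_gt _)))// ler_nat ltnS//.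
Qed.

End cutoff.

Lemma indic1 (R : realType) (T : Type) (S : set T) x : S x -> \1_S x = 1 :> R.
Proof. by move=> Sx; rewrite indicE mem_set. Qed.

Lemma indic0 (R : realType) (T : Type) (S : set T) x : ~ S x -> \1_S x = 0 :> R.
Proof. by move=> Sx; rewrite indicE memNset. Qed.

(** * The Riesz inequality and local integrability of the kernel *)

Section power_kernel.
Local Open Scope ereal_scope.
Context {R : realType} {d : nat} (d_gt0 : (0 < d)%N).
Local Notation V := 'cV[R]_d.
Local Notation lam := (@lebesgue_cV R d).
Local Notation w := (@unit_ball_volume R d).
Variable t : R.
Hypothesis t0 : (0 < t)%R.
Local Notation K := (fun u : R => u `^ (- t))%R.

Lemma lebesgue_cV_set1 (x : V) : lam [set x] = 0.
Proof.
rewrite (_ : [set x] = (fun z => z + - x)%R @^-1` [set z | (enorm z <= 0)%R]).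
  rewrite lebesgue_cV_preimage_shift; last exact: measurable_cball.
  by rewrite lebesgue_cV_cball// expr0n gtn_eqF//= mul0r.
apply/seteqP; split => z /=; first by move=> ->; rewrite subrr enorm0.
move=> zx; apply/eqP; rewrite -subr_eq0; apply/eqP/enorm0_eq0/eqP.
by rewrite eq_le zx enorm_ge0.
Qed.

(** Truncation lowers the kernel except on the diagonal, where the power is 0. For fixed [x] the
    exception is the single point [x], which is null because [d > 0]. *)
Lemma pair_energy_truncated_le n (B : set V) : measurable B ->
  pair_energy (truncated_power t n) \1_B \1_B <= pair_energy K \1_B \1_B.
Proof.
move=> mB; have mK : measurable_fun setT K by exact: measurable_powR.
have mI : measurable_fun setT (\1_B : V -> R) by exact: measurable_indic.
have B0 x : (0 <= \1_B x :> R)%R by rewrite indicE.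
have mT := measurable_pair_energy (measurable_truncated_power t n) mI mI.
have mP := measurable_pair_energy mK mI mI.
have T0 (p : V * V) : (0 <= \1_B p.1 * \1_B p.2 * truncated_power t n (enorm (p.1 - p.2)))%R.
  by rewrite !mulr_ge0// truncated_power_ge0.
have P0 (p : V * V) : (0 <= \1_B p.1 * \1_B p.2 * K (enorm (p.1 - p.2)))%R.
  by rewrite !mulr_ge0// powR_ge0.
rewrite /pair_energy fubini_tonelli1; [|exact/measurable_EFinP|by move=> p; rewrite lee_fin].
rewrite [leRHS]fubini_tonelli1; [|exact/measurable_EFinP|by move=> p; rewrite lee_fin].
have mTx x : measurable_fun setT (fun y : V => (\1_B x * \1_B y * truncated_power t n (enorm (x - y)))%:E).
  by apply/measurable_EFinP; exact: (measurable_fun_pair2 x mT).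
have mPx x : measurable_fun setT (fun y : V => (\1_B x * \1_B y * K (enorm (x - y)))%:E).
  by apply/measurable_EFinP; exact: (measurable_fun_pair2 x mP).
apply: ge0_le_integral => //.
- by move=> x _; apply: integral_ge0 => y _; rewrite lee_fin; exact: T0 (x, y).
- apply: measurable_fun_fubini_tonelli_F; first exact/measurable_EFinP.
  by move=> p; rewrite lee_fin.
- apply: measurable_fun_fubini_tonelli_F; first exact/measurable_EFinP.
  by move=> p; rewrite lee_fin.
- move=> x _; apply: ae_ge0_le_integral => //=.
  + by move=> y _; rewrite lee_fin; exact: T0 (x, y).
  + by move=> y _; rewrite lee_fin; exact: P0 (x, y).
  + exists [set x]; split; first 2 last.
    * move=> y /= nle; apply: contrapT => yx; apply: nle => _.
      rewrite lee_fin ler_wpM2l ?mulr_ge0// truncated_power_le_powR//.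
      rewrite lt_neqAle enorm_ge0 andbT eq_sym; apply/eqP => /enorm0_eq0/eqP.
      by rewrite subr_eq0 => /eqP xy; apply: yx; rewrite /= xy.
    * rewrite (_ : [set x] = (fun z => z + - x)%R @^-1` [set z | (enorm z <= 0)%R]).
        by rewrite -[X in measurable X]setTI; apply: (measurable_colvec_shift (- x)) => //; exact: measurable_cball.
      apply/seteqP; split => z /=; first by move=> ->; rewrite subrr enorm0.
      move=> zx; apply/eqP; rewrite -subr_eq0; apply/eqP/enorm0_eq0/eqP.
      by rewrite eq_le zx enorm_ge0.
    * exact: lebesgue_cV_set1.
Qed.

(** The cutoffs of [D] with the truncated kernel are compared with the ball, whose truncated energy
    is below its full one; the stage n then tends to infinity on the side of [D] only. *)
Lemma pair_energy_rearrangement (D : set V) (R0 r : R) : open D ->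
  D `<=` eball R0 -> (0 <= r)%R -> lam D = lam (eball r) ->
  pair_energy K \1_D \1_D <= pair_energy K \1_(@eball R d r) \1_(eball r).
Proof.
move=> oD DR0 r0 vD.
have mD := open_measurable_colvec oD.
(* Boundedness leaves a point outside [D], so the infimum in [cutoff] is over a nonempty set. *)
have DC0 : ~` D !=set0.
  exists (const_mx `|R0|%R) => /DR0; rewrite /eball/= => h.
  have := coord_le_enorm (const_mx `|R0|%R : V) (Ordinal d_gt0); rewrite mxE normr_id.
  by have := ler_norm R0; lra.
have c01 n x : (0 <= cutoff D n x <= 1)%R by rewrite cutoff_ge0// cutoff_le1.
have mc n : measurable_fun setT (cutoff D n).
  exact: measurable_elipschitz (cutoff_lipschitz DC0 n).
pose far n (p : V * V) : R := \1_[set p : V * V | (n.+1%:R^-1 <= enorm (p.1 - p.2))%R] p.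
have md : measurable_fun setT (fun p : V * V => enorm (p.1 - p.2)).
  exact: (measurableT_comp measurable_enorm measurable_colvecB).
have mK : measurable_fun setT K by exact: measurable_powR.
have mfar n : measurable_fun setT (far n).
  by apply: measurable_indic; exact: (measurable_set_le (measurable_cst _) md).
(* [far n] keeps the pairs on which the power and its truncation agree, so [g n] lies below the
   truncated integrand while increasing with [n]. *)
pose g n (p : V * V) : R := (cutoff D n p.1 * cutoff D n p.2 * K (enorm (p.1 - p.2)) * far n p)%R.
have far0 n p : (0 <= far n p)%R by rewrite /far indicE.
have g0 n p : (0 <= g n p)%R.
  by rewrite !mulr_ge0 ?cutoff_ge0 ?powR_ge0.
have mg n : measurable_fun setT (g n).
  apply: measurable_funM; last exact: mfar.
  exact: (measurable_pair_energy mK (mc n) (mc n)).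
have mI : measurable_fun setT (\1_D : V -> R) by exact: measurable_indic.
apply: (@integral_le_monotone _ _ _ _ _ g) => //.
- exact: (measurable_pair_energy mK mI mI).
- by move=> p; rewrite !mulr_ge0 ?powR_ge0 ?indicE.
- move=> n m p nm; apply: ler_pM; rewrite ?mulr_ge0 ?cutoff_ge0 ?powR_ge0//.
    by rewrite ler_wpM2r ?powR_ge0// ler_pM ?cutoff_ge0 ?cutoff_nondecreasing.
  rewrite /far !indicE ler_nat; case: (boolP (p \in _)) => //; rewrite inE/= => np.
  by rewrite mem_set//=; apply: le_trans np; rewrite lef_pV2 ?posrE// ler_nat ltnS.
- move=> [x y]; rewrite /g /=.
  have [Dx|Dx] := pselect (D x); last first.
    by exists 0%N; rewrite [(\1_D x)%R]indicE memNset// !mul0r !mulr_ge0 ?cutoff_ge0 ?powR_ge0.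
  have [Dy|Dy] := pselect (D y); last first.
    by exists 0%N; rewrite [(\1_D y)%R]indicE memNset// mulr0 mul0r !mulr_ge0 ?cutoff_ge0 ?powR_ge0.
  have [xy0|xy0] := eqVneq (enorm (x - y)) 0%R.
    by exists 0%N; rewrite xy0 (powR0N t0) mulr0 !mulr_ge0 ?cutoff_ge0 ?powR_ge0.
  have [n1 H1] := cutoff_eventually1 DC0 oD Dx.
  have [n2 H2] := cutoff_eventually1 DC0 oD Dy.
  have xy1 : (0 < enorm (x - y))%R by rewrite lt_neqAle enorm_ge0 eq_sym xy0.
  pose n := maxn (maxn n1 n2) (Num.truncn (enorm (x - y))^-1).
  exists n; rewrite H1 ?H2/=; last 2 first.
  - by rewrite /n !leq_max leqnn orbT.
  - by rewrite /n !leq_max leqnn.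
  rewrite /far !indicE !mem_set//= ?mulr1//.
  rewrite invf_ple ?posrE// (le_trans (ltW (truncnS_gt _)))// ler_nat ltnS.
  by rewrite /n leq_maxr.
- move=> n.
  apply: (@le_trans _ _ (pair_energy (truncated_power t n) (cutoff D n) (cutoff D n))).
    apply: ge0_le_integral => //.
    + by move=> p _; rewrite lee_fin.
    + exact/measurable_EFinP.
    + apply/measurable_EFinP; apply: measurable_pair_energy => //.
      exact: measurable_truncated_power.
    + move=> p _; rewrite lee_fin /g /far indicE.
      case: (boolP (p \in _)); rewrite ?mulr1 ?mulr0; last first.
        by rewrite !mulr_ge0 ?cutoff_ge0 ?truncated_power_ge0.
      rewrite inE/= => np; rewrite ler_wpM2l ?mulr_ge0 ?cutoff_ge0//.
      by rewrite (powR_le_truncated_power t np).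
  apply: le_trans (@pair_energy_truncated_le n (eball r) _); last exact: measurable_eball.
  (* The support radius is enlarged to [Num.max R0 r] because the comparison wants it to be at least
     [r]. *)
  apply: (@pair_energy_le_ball _ _ d_gt0 _ (n.+1%:R^-1 `^ (- t))%R _ _ _ _ n.+1%:R (Num.max R0 r)) => //.
  + exact: measurable_truncated_power.
  + exact: truncated_power_ge0.
  + exact: truncated_power_le.
  + by move=> u v; exact: truncated_power_nincr.
  + by rewrite le_max lexx orbT.
  + exact: cutoff_lipschitz.
  + move=> x Rx; apply: cutoff_out => // /DR0; rewrite /eball/= => xR.
    by move: Rx; rewrite ge_max => /andP[]; lra.
  + rewrite -vD; apply: le_measure; rewrite ?inE//; first exact: measurable_set_lt.
    move=> x /= cx; apply: contrapT => Dx; move: cx.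
    by rewrite cutoff_out// ltxx.
Qed.

(* [|z|^-t] on the annuli between radii [rho / 2^n]: the n-th one contributes a
   multiple of [(2^(t-d))^n]. *)
Lemma integral_power_ball (rho : R) : (0 < rho)%R -> (t < d%:R)%R ->
  \int[lam]_z (\1_(eball rho) z * K (enorm z))%:E < +oo.
Proof.
move=> rho0 td.
have mK : measurable_fun setT (fun z : V => K (enorm z)).
  by apply: (measurableT_comp (@measurable_powR R (- t)%R)); exact: measurable_enorm.
pose a n : R := (rho * 2^-1 ^+ n)%R.
have a0 n : (0 < a n)%R by rewrite mulr_gt0// exprn_gt0// invr_gt0.
have aS n : (a n.+1 = a n * 2^-1)%R by rewrite /a exprSr mulrA.
pose g N (z : V) : R := (\1_(eball rho) z * K (enorm z) * \1_[set z | (a N <= enorm z)%R] z)%R.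
pose c n : R := (K (a n.+1)).
have mball s : measurable (@eball R d s) by exact: measurable_eball.
have mfar N : measurable [set z : V | (a N <= enorm z)%R].
  by apply: measurable_set_le => //; exact: measurable_enorm.
have mg N : measurable_fun setT (g N).
  apply: measurable_funM; last exact: measurable_indic.
  by apply: measurable_funM => //; exact: measurable_indic.
have g0 N z : (0 <= g N z)%R by rewrite !mulr_ge0 ?powR_ge0 ?indicE.
(* A point between the radii [a n.+1] and [a n] is charged to the ball of radius [a n], with the
   kernel taken at the inner radius. *)
have gc N z : (g N z <= \sum_(n < N) c n * \1_(eball (a n)) z)%R.
  elim: N => [|N IH].
    rewrite big_ord0 /g; have [za|za] := ltP (enorm z) (a 0%N).
      by rewrite [X in (_ * X)%R]indic0 ?mulr0//=; apply/negP; rewrite -ltNge.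
    rewrite [(\1_(eball rho) z)%R]indic0 ?mul0r//= /eball/=; apply/negP; rewrite -leNgt.
    by move: za; rewrite /a expr0 mulr1.
  rewrite big_ord_recr/=; have [za|za] := ltP (enorm z) (a N).
    have [za1|za1] := ltP (enorm z) (a N.+1).
      rewrite /g [X in (_ * X)%R]indic0/= ?mulr0; last by apply/negP; rewrite -ltNge.
      apply: addr_ge0; last by rewrite mulr_ge0 ?powR_ge0 ?indicE.
      by apply: sumr_ge0 => i _; rewrite mulr_ge0 ?powR_ge0 ?indicE.
    rewrite [(\1_(eball (a N)) z)%R]indic1//= mulr1.
    apply: ler_wpDl; first by apply: sumr_ge0 => i _; rewrite mulr_ge0 ?powR_ge0 ?indicE.
    rewrite /g; apply: (@le_trans _ _ (1 * K (enorm z) * 1)%R).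
      apply: ler_pM; rewrite ?mulr_ge0 ?powR_ge0 ?indicE ?lern1 ?leq_b1//.
      by rewrite ler_wpM2r ?powR_ge0// lern1 leq_b1.
    by rewrite mul1r mulr1; exact: powRN_le.
  apply: ler_wpDr; first by rewrite mulr_ge0 ?powR_ge0 ?indicE.
  apply: le_trans IH; rewrite /g ler_wpM2l ?mulr_ge0 ?powR_ge0 ?indicE//.
  by rewrite -!indicE [leRHS]indic1// indicE lern1 leq_b1.
pose q : R := (2 `^ t * 2^-1 ^+ d)%R.
have q0 : (0 <= q)%R by rewrite mulr_ge0 ?powR_ge0// exprn_ge0// invr_ge0.
have qE : (q = 2 `^ (t - d%:R))%R.
  by rewrite /q exprVn -powR_mulrn// -powRN -powRD//; apply/implyP => /eqP; lra.
have q1 : (q < 1)%R.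
  rewrite qE /powR gt_eqF// -[ltRHS]expR0 ltr_expR nmulr_rlt0 ?subr_lt0//.
  by rewrite ln_gt0// ltr1n.
pose C : R := (K (a 1%N) * a 0%N ^+ d * w)%R.
have C0 : (0 <= C)%R by rewrite !mulr_ge0 ?powR_ge0 ?exprn_ge0 ?(ltW (a0 _))// ltW// unit_ball_volume_gt0.
have cE n : (c n * (a n ^+ d * w) = C * q ^+ n)%R.
  elim: n => [|n IH]; first by rewrite /C expr0 mulr1 mulrA.
  have h2 : (2^-1 `^ (- t) = 2 `^ t :> R)%R.
    by rewrite -powR_inv1// -powRrM mulN1r opprK.
  have -> : (c n.+1 = c n * 2 `^ t)%R.
    by rewrite /c (aS n.+1) powRM ?h2// ltW.
  rewrite exprSr [RHS]mulrA -IH aS exprMn /q; ring.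
have bound N : \int[lam]_z (g N z)%:E <= (C * (1 - q)^-1)%:E.
  have mc (n : nat) : measurable_fun setT (fun z : V => (c n * \1_(eball (a n)) z)%R).
    by apply: measurable_funM => //; exact: measurable_indic.
  apply: (@le_trans _ _ (\int[lam]_z (\sum_(n < N) c n * \1_(eball (a n)) z)%:E)).
    apply: ge0_le_integral => //.
    - by move=> z _; rewrite lee_fin.
    - exact/measurable_EFinP.
    - apply/measurable_EFinP; apply: measurable_sum => n; exact: mc.
    - by move=> z _; rewrite lee_fin.
  under eq_integral do rewrite -sumEFin.
  rewrite ge0_integral_sum//; last 2 first.
  - by move=> n; apply/measurable_EFinP; exact: mc.
  - by move=> n z _; rewrite lee_fin mulr_ge0 ?powR_ge0 ?indicE.
  rewrite (eq_bigr (fun n : 'I_N => (C * q ^+ n)%:E)); last first.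
    move=> n _; under eq_integral do rewrite EFinM.
    rewrite ge0_integralZl_EFin ?powR_ge0//; last first.
      by apply/measurable_EFinP; exact: measurable_indic.
    rewrite integral_indic// setIT -[X in _ * X]/(lam (eball (a n))).
    by rewrite lebesgue_cV_eball ?ltW// -EFinM cE.
  rewrite sumEFin lee_fin -mulr_sumr ler_wpM2l// -[leRHS]mul1r ler_pdivlMr ?subr_gt0//.
  rewrite mulrC -opprB mulNr -subrX1 opprB lerBlDr lerDl.
  exact: exprn_ge0.
apply: (@le_lt_trans _ _ (C * (1 - q)^-1)%:E); last exact: ltry.
apply: (@integral_le_monotone _ _ _ _ _ g) => //.
- by apply: measurable_funM => //; exact: measurable_indic.
- by move=> z; rewrite mulr_ge0 ?powR_ge0 ?indicE.
- move=> n m z nm; rewrite ler_wpM2l ?mulr_ge0 ?powR_ge0 ?indicE// ler_nat.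
  case: (boolP (z \in _)) => //; rewrite inE/= => az.
  rewrite mem_set//=; apply: le_trans az; rewrite ler_pM2l// !exprVn lef_pV2 ?posrE ?exprn_gt0//.
  by rewrite ler_eXn2l// ltr1n.
- move=> z; have [z0|z0] := eqVneq (enorm z) 0%R.
    by exists 0%N; rewrite z0 (powR0N t0) mulr0.
  have {}z0 : (0 < enorm z)%R by rewrite lt_neqAle enorm_ge0 eq_sym z0.
  (* For n > rho / enorm z, the inequality 2^n > n gives [a n <= enorm z]. *)
  exists (Num.truncn (rho / enorm z)).+1; rewrite /g [X in (_ <= _ * X)%R]indic1 ?mulr1//=.
  rewrite /a exprVn ler_pdivrMr ?exprn_gt0// mulrC -ler_pdivrMr//.
  rewrite (le_trans (ltW (truncnS_gt _)))// -natrX ler_nat.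
  exact: ltnW (ltn_expl _ _).
Qed.

End power_kernel.

(** * Riesz integrals of balls, and boundaries of balls *)

Section riesz_integrals.
Local Open Scope ereal_scope.
Context {R : realType} {d : nat} (d_gt0 : (0 < d)%N).
Local Notation V := 'cV[R]_d.
Local Notation lam := (@lebesgue_cV R d).
Variable t : R.
Hypothesis t0 : (0 < t)%R.
Local Notation K := (fun u : R => u `^ (- t))%R.

(** Two points of the ball differ by a vector of norm below [rho]; for fixed [y], translation bounds
    the inner integral by that of the kernel over the ball of radius [rho]. *)
Lemma pair_energy_eball_ltey (r : R) : (0 <= r)%R -> (t < d%:R)%R ->
  pair_energy K \1_(@eball R d r) \1_(eball r) < +oo.
Proof.
(* The added 1 keeps [rho] positive when [r = 0]. *)
move=> r0 td; pose rho := (2 * r + 1)%R.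
have rho0 : (0 < rho)%R by rewrite /rho; lra.
pose h (z : V) : R := (\1_(eball rho) z * K (enorm z))%R.
pose b : V -> R := \1_(eball r).
have mK : measurable_fun setT K by exact: measurable_powR.
have mball s : measurable (@eball R d s) by exact: measurable_eball.
have mb : measurable_fun setT b by exact: measurable_indic.
have mh : measurable_fun setT h.
  apply: measurable_funM; first exact: measurable_indic.
  exact: (measurableT_comp mK measurable_enorm).
have h0 z : (0 <= h z)%R by rewrite mulr_ge0 ?powR_ge0 ?indicE.
have b0 z : (0 <= b z)%R by rewrite /b indicE.
have mbh : measurable_fun setT (fun p : V * V => b p.2 * h (p.1 - p.2))%R.
  apply: measurable_funM; first exact: (measurableT_comp mb).
  exact: (measurableT_comp mh measurable_colvecB).
apply: (@le_lt_trans _ _ (\int[lam \x lam]_p (b p.2 * h (p.1 - p.2))%:E)).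
  apply: ge0_le_integral => //.
  - by move=> p _; rewrite lee_fin !mulr_ge0 ?powR_ge0.
  - by apply/measurable_EFinP; exact: (measurable_pair_energy mK mb mb).
  - exact/measurable_EFinP.
  - move=> [x y] _; rewrite lee_fin /=.
    have [xr|xr] := pselect (eball r x); last by rewrite indic0// !mul0r mulr_ge0.
    rewrite (indic1 _ xr) mul1r.
    have [yr|yr] := pselect (eball r y); last by rewrite indic0// mul0r mulr_ge0.
    rewrite /b (indic1 _ yr) !mul1r /h [X in (_ <= X * _)%R]indic1 ?mul1r//.
    move: xr yr; rewrite /eball/= => xr yr.
    by have := ler_enormD x (- y); rewrite enormN /rho; lra.
rewrite fubini_tonelli2; [|exact/measurable_EFinP|by move=> p; rewrite lee_fin mulr_ge0].
rewrite (_ : (fun y => _) = (fun y => (b y)%:E * \int[lam]_z (h z)%:E)); last first.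
  apply/funext => y.
  have mhy : measurable_fun setT (fun x : V => (h (x - y))%:E).
    by apply/measurable_EFinP; exact: (measurableT_comp mh (measurable_colvec_shift (- y))).
  transitivity (\int[lam]_x ((b y)%:E * (h (x - y))%:E)).
    by apply: eq_integral => x _.
  rewrite (ge0_integralZl_EFin lam measurableT _ mhy (b0 y)); last first.
    by move=> x _; rewrite lee_fin.
  rewrite (integral_lebesgue_cV_shift (- y)%R (F := fun x => (h x)%:E))//.
  exact/measurable_EFinP.
have I0 : 0 <= \int[lam]_z (h z)%:E by apply: integral_ge0 => z _; rewrite lee_fin.
rewrite ge0_integralZr//; last 2 first.
- exact/measurable_EFinP.
- by move=> y _; rewrite lee_fin.
have -> : \int[lam]_x (b x)%:E = lam (eball r) by rewrite integral_indic// setIT.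
have hf : \int[lam]_z (h z)%:E < +oo by exact: integral_power_ball.
by rewrite lebesgue_cV_eball// lte_mul_pinfty// lee_fin mulr_ge0 ?exprn_ge0// ltW// unit_ball_volume_gt0.
Qed.

Lemma integral_nu (A : 'M[R]_d) (f : V -> \bar R) :
  measurable_fun setT f -> (forall x, 0 <= f x) ->
  \int[nu A]_x f x = (covolume A)%:E * \int[lam]_x f x.
Proof.
move=> mf f0; rewrite (eq_measure_integral (mscale (NngNum (covolume_ge0 A)) lam)).
  by rewrite ge0_integral_mscale.
by [].
Qed.

Lemma riesz_integralE (A : 'M[R]_d) (D : set V) : measurable D ->
  riesz_integral A D t = (covolume A)%:E * ((covolume A)%:E * pair_energy K \1_D \1_D).
Proof.
move=> mD; rewrite /riesz_integral integral_mkcond.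
pose F (p : V * V) : \bar R := (\1_D p.1 * \1_D p.2 * K (enorm (p.1 - p.2)))%:E.
rewrite (_ : _ \_ _ = F); last first.
  apply/funext => -[x y]; rewrite /F patchE /=.
  have [/set_mem[/= Dx Dy]|xy] := boolP (_ \in _).
    by rewrite !indic1// !mul1r.
  have [Dx|Dx] := pselect (D x); last by rewrite (indic0 _ Dx) !mul0r.
  have [Dy|Dy] := pselect (D y); last by rewrite (indic0 _ Dy) mulr0 mul0r.
  by move: xy; rewrite mem_set.
have mK : measurable_fun setT K by exact: measurable_powR.
have mI : measurable_fun setT (\1_D : V -> R) by exact: measurable_indic.
have mF : measurable_fun setT F.
  by apply/measurable_EFinP; exact: (measurable_pair_energy mK mI mI).
have F0 p : 0 <= F p by rewrite lee_fin !mulr_ge0 ?powR_ge0 ?indicE.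
have c0 : 0 <= (covolume A)%:E by rewrite lee_fin covolume_ge0.
rewrite (fubini_tonelli1 (m1 := nu A) (m2 := nu A) F mF F0) integral_nu; last 2 first.
- exact: measurable_fun_fubini_tonelli_F.
- by move=> x; exact: integral_ge0.
congr (_ * _); rewrite /pair_energy -[X in _ = _ * X]/(\int[lam \x lam]_p F p).
rewrite (fubini_tonelli1 F mF F0).
rewrite -ge0_integralZl//; last 2 first.
- by apply: measurable_fun_fubini_tonelli_F.
- by move=> x _; exact: integral_ge0.
apply: eq_integral => x _; rewrite /fubini_F integral_nu//.
exact: measurable_fun_pair2.
Qed.

Lemma closed_cball (r : R) : closed [set x : V | (enorm x <= r)%R].
Proof.
rewrite -openC; apply/open_eballP => x /= /negP; rewrite -ltNge => xr.
exists (enorm x - r)%R; first by rewrite subr_gt0.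
by move=> y xy; apply/negP; rewrite -ltNge; have := ler_enormD (x - y) y; rewrite subrK; lra.
Qed.

(** The closure stays in the closed Euclidean ball, so the boundary lies in a sphere, which is
    null. *)
Lemma eball_boundary (r : R) : (0 <= r)%R ->
  lam (closure (@eball R d r) `\` (eball r)°) = 0.
Proof.
move=> r0; have oB := @open_eball R d r.
have mC : measurable (closure (@eball R d r)).
  rewrite -[X in measurable X]setCK; apply: measurableC; apply: open_measurable_colvec.
  by rewrite openC; exact: closed_closure.
rewrite (proj1 (interior_id _) oB).
apply: (subset_measure0 (B := [set x : V | enorm x = r])).
- by apply: measurableD => //; exact: measurable_eball.
- rewrite (_ : [set x : V | enorm x = r] = [set x | (enorm x <= r)%R] `\` eball r).
    by apply: measurableD; [exact: measurable_cball|exact: measurable_eball].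
  apply/seteqP; split=> x; rewrite /eball/=; first by move=> ->; rewrite lexx ltxx.
  by move=> [xr] /negP; rewrite -leNgt => rx; apply/eqP; rewrite eq_le xr.
- move=> x [cx] /= /negP; rewrite -leNgt => rx; apply/eqP; rewrite eq_le rx andbT.
  have : closure [set x : V | (enorm x <= r)%R] x.
    by apply: closure_subset cx => y; rewrite /eball/= => /ltW.
  by rewrite -(proj1 (closure_id _) (@closed_cball r)).
- exact: lebesgue_cV_sphere.
Qed.

Lemma bounded_eball (r : R) : bounded_set (@eball R d r).
Proof.
exists r; split; first exact: num_real.
move=> M rM x /= xr; rewrite (le_trans (mx_norm_le_enorm _))//.
by rewrite ltW// (lt_trans xr).
Qed.

Lemma bounded_set_sub_eball (D : set V) : bounded_set D -> exists R0, D `<=` eball R0.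
Proof.
move=> [M [_ HM]]; exists (d%:R * (M + 1) + 1)%R => x Dx; rewrite /eball/=.
have xM : (`|x| <= M + 1)%R by apply: HM => //; rewrite ltrDl.
by rewrite (le_lt_trans (enorm_le_mx_norm _))// ltr_pwDr// ler_wpM2l.
Qed.

End riesz_integrals.
From mathcomp Require finmap.

(** * Lattice points and the expansion *)

Section lattice_points.
Context {R : realType} {d : nat}.
Local Notation V := 'cV[R]_d.

Lemma enorm_mulmx_le n (B : 'M[R]_(d, n)) (u : 'cV[R]_n) (M : R) :
  (forall i, `|u i ord0| <= M) -> enorm (B *m u) <= (\sum_i \sum_j `|B i j|) * M.
Proof.
move=> uM; rewrite (le_trans (enorm_le_sum _))// mulr_suml ler_sum// => i _.
rewrite mxE (le_trans (ler_norm_sum _ _ _))// mulr_suml ler_sum// => j _.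
by rewrite normrM ler_wpM2l.
Qed.

Lemma finite_bounded_int_vectors n (M : nat) :
  finite_set [set m : 'cV[int]_n | forall i, (`|m i ord0| <= M)%N].
Proof.
apply: (@sub_finite_set _ _ [set (\col_i ((f i : nat)%:Z - M%:Z))%R | f in [set: {ffun 'I_n -> 'I_(M + M).+1}]]).
  move=> m /= mM.
  have mi' i : 0 <= m i ord0 + M%:Z <= M%:Z + M%:Z.
    have := mM i; rewrite -lez_nat abszE ler_norml => /andP[h1 h2].
    by rewrite lerD2r h2 andbT -lerBlDr sub0r.
  have mi i : (absz (m i ord0 + M%:Z)%R < (M + M).+1)%N.
    by have /andP[h1 h2] := mi' i; rewrite ltnS -lez_nat gez0_abs// PoszD.
  exists [ffun i => Ordinal (mi i)] => //.
  apply/matrixP => i j; rewrite mxE ffunE (ord1 j) /=.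
  by have /andP[h1 h2] := mi' i; rewrite gez0_abs// addrK.
exact: finite_image.
Qed.

Variables (A : 'M[R]_d) (D : set V).
Hypothesis uA : A \in unitmx.

Let uAT : A^T \in unitmx. Proof. by rewrite unitmx_tr. Qed.

(** Multiplying by [A^T] recovers the integer coordinates, which are bounded. Finiteness makes
    [fset_set], hence [level_card], the actual count instead of its default value. *)
Lemma finite_level_set N (R0 : R) : D `<=` eball R0 -> finite_set (level_set A D N).
Proof.
move=> DR0; pose c : R := N%:R `^ d%:R^-1.
have c0 : 0 <= c by exact: powR_ge0.
pose S : R := (\sum_i \sum_j `|A^T i j|) * (c * R0).
apply: (@sub_finite_set _ _ [set invmx A^T *m map_mx intr m |
    m in [set m : 'cV[int]_d | forall i, (`|m i ord0| <= Num.truncn S)%N]]).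
  move=> w [[m _ mw] [x Dx xw]]; exists m => // i /=.
  have mE : map_mx intr m = A^T *m w :> V by rewrite -mw mulKVmx.
  have wR j : `|w j ord0| <= c * R0.
    rewrite (le_trans (coord_le_enorm _ _))// -xw enormZ ger0_norm// ler_wpM2l//.
    by rewrite ltW//; exact: DR0.
  have := le_trans (coord_le_enorm (map_mx intr m : V) i)
    (le_trans (eq_ind_r (fun u => enorm u <= _) (enorm_mulmx_le _ wR) mE) (lexx _)).
  rewrite mxE -intr_norm -/S => mS.
  have S0 : 0 <= S by apply: le_trans mS.
  rewrite truncn_ge_nat//; move: mS; by rewrite -natz_abs.
exact/finite_image/finite_bounded_int_vectors.
Qed.

(** Round N^(1/d) p to the dual lattice by taking floors of its lattice coordinates. The error is
    bounded independently of N, so after rescaling it falls below [e]. *)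
Lemma level_set_nonempty (p : V) (e : R) : (0 < d)%N -> 0 < e ->
  (forall y, enorm (p - y) < e -> D y) ->
  exists N0, forall N, (N0 <= N)%N -> level_set A D N !=set0.
Proof.
move=> d0 e0 De; pose B := invmx A^T.
pose C : R := (\sum_i \sum_j `|B i j|) * 1.
have C0 : 0 <= C by rewrite /C mulr1 sumr_ge0// => i _; rewrite sumr_ge0.
(* Chosen so that C < e X; the scale N^(1/d) reaches [X] once N is at least X^d. *)
pose X : R := C / e + 1.
have X0 : 0 < X by rewrite ltr_wpDl ?divr_ge0// ltW.
exists (Num.truncn (X ^+ d)).+1 => N hN; pose c : R := N%:R `^ d%:R^-1.
have cX : X <= c.
  have -> : X = (X ^+ d) `^ d%:R^-1.
    by rewrite -powR_mulrn ?(ltW X0)// -powRrM mulfV ?powRr1 ?(ltW X0)// pnatr_eq0 -lt0n.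
  rewrite ge0_ler_powR ?nnegrE ?exprn_ge0 ?(ltW X0)//.
  by rewrite (le_trans (ltW (truncnS_gt _)))// ler_nat.
have c0 : 0 < c by exact: lt_le_trans cX.
pose v : V := A^T *m (c *: p).
pose m : 'cV[int]_d := \col_i Num.floor (v i ord0).
pose z : V := B *m map_mx intr m.
exists z; split; first by exists m.
exists (c^-1 *: z); last by rewrite scalerA mulfV ?gt_eqF// scale1r.
apply: De; have -> : p - c^-1 *: z = c^-1 *: (B *m (v - map_mx intr m)).
  rewrite mulmxBr /v /B mulKmx// scalerBr scalerA mulVf ?gt_eqF// scale1r.
  by [].
rewrite enormZ gtr0_norm ?invr_gt0// mulrC ltr_pdivrMr//.
have bnd : enorm (B *m (v - map_mx intr m)) <= C.
  apply: enorm_mulmx_le => i.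
  have -> : (v - map_mx intr m) i ord0 = v i ord0 - (Num.floor (v i ord0))%:~R.
    by rewrite mxE; congr (_ + _); rewrite 3!mxE.
  have := floor_le_tmp (v i ord0); have := floorD1_gt (v i ord0); rewrite intrD rmorph1.
  move=> h1 h2; rewrite ger0_norm ?subr_ge0//; lra.
apply: (le_lt_trans bnd); apply: (@lt_le_trans _ _ (e * X)).
  by rewrite mulrDr mulrCA mulfV ?gt_eqF// !mulr1 ltrDl.
by rewrite ler_wpM2l// ltW.
Qed.

Lemma level_card_gt0 : (0 < d)%N -> open D -> bounded_set D -> D !=set0 ->
  exists N0, forall N, (N0 <= N)%N -> (0 < level_card A D N)%N.
Proof.
move=> d0 /open_eballP oD /bounded_set_sub_eball[R0 DR0] [p /oD[e e0 De]].
have [N0 H] := level_set_nonempty d0 e0 De.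
exists N0 => N /H[w Hw]; rewrite /level_card finmap.cardfs_gt0.
apply/finmap.fset0Pn; exists w; rewrite in_fset_set ?mem_set//.
exact: finite_level_set DR0.
Qed.

End lattice_points.

(** Subtracting the two expansions makes (c - c') t_N^(1+s/d) negligible against t_N^(1+s/d), which
    is eventually positive. *)
Lemma energy_expansion_unique (R : realType) (d : nat) (A : 'M[R]_d) (s : R)
    (D : set 'cV[R]_d) (c c' : R) (E : nat -> R) :
  (exists N0, forall N, (N0 <= N)%N -> (0 < level_card A D N)%N) ->
  energy_expansion A s D c E -> energy_expansion A s D c' E -> c = c'.
Proof.
move=> [N0 HN0] /eqoP H /eqoP H'; apply/eqP; rewrite -subr_eq0 -normr_le0.
apply/ler_addgt0Pr => e e0; rewrite add0r.
have e2 : 0 < e / 2 by rewrite divr_gt0.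
have [N1 _ H1] := H _ e2; have [N2 _ H2] := H' _ e2.
pose N := maxn N0 (maxn N1 N2).
have := H1 N; have := H2 N; rewrite /= /N !leq_max !leqnn !orbT -/N.
move=> /(_ isT) h2 /(_ isT) h1.
have : (0 < level_card A D N)%N by apply: HN0; rewrite leq_maxl.
move: h1 h2; set n := level_card A D N => h1 h2 n0.
have tau0 : 0 < n%:R `^ (1 + s / d%:R) :> R by rewrite powR_gt0// ltr0n.
move: h1 h2; rewrite (gtr0_norm tau0).
set tau := _ `^ _ in tau0 *; set X := E N - _ => h1 h2.
rewrite -(ler_pM2r tau0) -{1}(gtr0_norm tau0) -normrM.
rewrite (_ : (c - c') * tau = (X - c' * tau) - (X - c * tau)); last by ring.
by rewrite (le_trans (ler_normB _ _))// (le_trans (lerD h2 h1))// -mulrDl -splitr.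
Qed.

(** * The symmetrized set and the second coefficient *)

Section main_statements.
Context {R : realType} {d : nat} (d_gt0 : (0 < d)%N).
Variable A : 'M[R]_d.
Local Notation V := 'cV[R]_d.
Local Notation lam := (@lebesgue_cV R d).

Lemma admissible_ltey (D : set V) : admissible A D -> (lam D < +oo)%E.
Proof.
move=> [oD /bounded_set_sub_eball[R0 DR0] _ _].
apply: (le_lt_trans _ (@lebesgue_cV_eball_ltey R d R0)); apply: le_measure; rewrite ?inE;
  [exact: open_measurable_colvec|exact: measurable_eball|exact: DR0].
Qed.

Lemma admissible_nonempty (D : set V) : admissible A D -> D !=set0.
Proof.
move=> [_ _ _ vD]; apply/set0P/eqP => D0; move: vD; rewrite D0 measure0 mul0e.
by move=> /esym/eqP; rewrite onee_eq0.
Qed.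

Lemma symmetrizationE (D : set V) : symmetrization D =
  eball ((fine (lam D) / @unit_ball_volume R d) `^ d%:R^-1).
Proof.
rewrite /symmetrization sphere_areaE//; congr (eball (_ `^ _)).
have w0 := @unit_ball_volume_gt0 R d.
have dn0 : d%:R != 0 :> R by rewrite pnatr_eq0 -lt0n.
by field; rewrite dn0 gt_eqF.
Qed.

Lemma lebesgue_cV_symmetrization (D : set V) : (lam D < +oo)%E ->
  lam (symmetrization D) = lam D.
Proof.
move=> Doo; have w0 := @unit_ball_volume_gt0 R d.
have q0 : 0 <= fine (lam D) / @unit_ball_volume R d.
  by rewrite divr_ge0 ?fine_ge0// ltW.
rewrite symmetrizationE lebesgue_cV_eball ?powR_ge0//.
rewrite -powR_mulrn ?powR_ge0// -powRrM mulVf ?pnatr_eq0 -?lt0n// powRr1//.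
by rewrite divfK ?gt_eqF// fineK// ge0_fin_numE.
Qed.

Lemma admissible_symmetrization (D : set V) :
  admissible A D -> admissible A (symmetrization D).
Proof.
move=> aD; have [_ _ _ vD] := aD; split.
- exact: open_eball.
- exact: bounded_eball.
- by rewrite symmetrizationE eball_boundary// powR_ge0.
- by rewrite lebesgue_cV_symmetrization// (admissible_ltey aD).
Qed.

(** The coefficient applies [fine], which is monotone only between finite values; finiteness for the
    ball passes to [D] by the Riesz inequality. *)
Lemma riesz_integral_symmetrization_ltey (D : set V) (t : R) : 0 < t -> t < d%:R ->
  (riesz_integral A (symmetrization D) t < +oo)%E.
Proof.
move=> t0 td; rewrite symmetrizationE riesz_integralE//; last exact: measurable_eball.
have c0 : (0 <= (covolume A)%:E)%E by rewrite lee_fin covolume_ge0.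
rewrite lte_mul_pinfty// lte_mul_pinfty//; exact: (pair_energy_eball_ltey d_gt0 t0 (powR_ge0 _ _) td).
Qed.

Lemma riesz_integral_symmetrization (D : set V) (t : R) : 0 < t ->
  admissible A D ->
  (riesz_integral A D t <= riesz_integral A (symmetrization D) t)%E.
Proof.
move=> t0 aD; have [oD /bounded_set_sub_eball[R0 DR0] _ _] := aD.
rewrite symmetrizationE !riesz_integralE//; last 2 first.
- exact: measurable_eball.
- exact: open_measurable_colvec.
have c0 : (0 <= (covolume A)%:E)%E by rewrite lee_fin covolume_ge0.
do 2 apply: lee_wpmul2l => //.
apply: (pair_energy_rearrangement d_gt0 t0 oD DR0); first exact: powR_ge0.
by rewrite -symmetrizationE lebesgue_cV_symmetrization// (admissible_ltey aD).
Qed.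

Lemma second_coefficient_symmetrization (D : set V) (s : R) : 0 < s < d%:R ->
  admissible A D ->
  second_coefficient A s (symmetrization D) <= second_coefficient A s D.
Proof.
move=> /andP[s0 sd] aD; have t0 : 0 < d%:R - s by rewrite subr_gt0.
have td : d%:R - s < d%:R :> R by rewrite ltrBlDr ltrDl.
have Gamma_ge0 (x : R) : 0 <= Gamma x.
  by apply: Rintegral_ge0 => u _; rewrite mulr_ge0 ?powR_ge0 ?expR_ge0.
rewrite /second_coefficient ler_wnM2l//.
  by rewrite oppr_le0 divr_ge0 ?mulr_ge0 ?powR_ge0 ?covolume_ge0.
have oo := riesz_integral_symmetrization_ltey D t0 td.
have le := riesz_integral_symmetrization t0 aD.
have ge0 (S : set V) : (0 <= riesz_integral A S (d%:R - s))%E.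
  by apply: integral_ge0 => p _; rewrite lee_fin powR_ge0.
by rewrite fine_le// ge0_fin_numE// (le_lt_trans le).
Qed.

End main_statements.

Unset Implicit Arguments.
Set Strict Implicit.

Theorem mainTheorem3 (R : realType) (d : nat) (A : 'M[R]_d) (s : R) :
  (0 < d)%N -> A \in unitmx -> 0 < s < d%:R ->
  forall D : set 'cV[R]_d, admissible A D ->
  [/\ admissible A (symmetrization D),
      lebesgue_cV (symmetrization D) = lebesgue_cV D,
      (riesz_integral A D (d%:R - s)
         <= riesz_integral A (symmetrization D) (d%:R - s))%E,
      second_coefficient A s (symmetrization D) <= second_coefficient A s D &
      (forall D' E, admissible A D' ->
         (forall N, is_expected_energy A s D' N (E N)) ->
         energy_expansion A s D' (second_coefficient A s D') E) ->
      forall (c c' : R) (E E' : nat -> R),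
        (forall N, is_expected_energy A s D N (E N)) ->
        (forall N, is_expected_energy A s (symmetrization D) N (E' N)) ->
        energy_expansion A s D c E ->
        energy_expansion A s (symmetrization D) c' E' ->
        c' <= c].
Proof.
move=> d0 uA sd D aD.
have aDs := admissible_symmetrization d0 aD.
have le2 := second_coefficient_symmetrization d0 sd aD.
split => //.
- exact: lebesgue_cV_symmetrization (admissible_ltey aD).
- apply: riesz_integral_symmetrization => //.
  by move: sd => /andP[_ sd]; rewrite subr_gt0.
- move=> expand c c' E E' eE eE' cE cE'.
  (* The assumed expansion and uniqueness identify both [c] and [c'] with the explicit coefficients
     already compared. *)
  have unique D' e F : admissible A D' ->
      (forall N, is_expected_energy A s D' N (F N)) ->
      energy_expansion A s D' e F -> e = second_coefficient A s D'.
    move=> aD' eF; have [oD' bD' _ _] := aD'.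
    have := expand D' F aD' eF => x2 x1; apply: energy_expansion_unique x1 x2.
    exact: level_card_gt0 (admissible_nonempty aD').
  by rewrite (unique _ _ _ aD eE cE) (unique _ _ _ aDs eE' cE').
Qed.
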